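(* Let $\omega,\alpha\in\mathbb{R}$ be such that $\omega>\alpha^2$. All minimizers of the problem $$d(\omega)=\inf\left\{S_\omega(v)\ :\ K_\omega(v)=0,\ v\in H^1(\mathbb{R}^+)\setminus\{0\}\right\}$$ are of the form $e^{i\theta}\varphi$, where $\theta\in\mathbb{R}$ and $\varphi$ is given, for $x>0$, by $$\varphi(x)=2\sqrt[4]{\omega}\,\operatorname{sech}^{\frac12}\left(2\sqrt{\omega}\,|x|+\tanh^{-1}\left(\frac{-\alpha}{\sqrt{\omega}}\right)\right).$$
   Context: Functions are complex-valued and $\mathbb{R}^+=(0,\infty)$. For $v\in H^1(\mathbb{R}^+)$, $$S_\omega(v)=\tfrac12\left[\|v_x\|_{L^2(\mathbb{R}^+)}^2+\omega\|v\|_{L^2(\mathbb{R}^+)}^2+\alpha|v(0)|^2\right]-\tfrac1{32}\|v\|_{L^6(\mathbb{R}^+)}^6,$$ $$K_\omega(v)=\|v_x\|_{L^2(\mathbb{R}^+)}^2+\omega\|v\|_{L^2(\mathbb{R}^+)}^2+\alpha|v(0)|^2-\tfrac3{16}\|v\|_{L^6(\mathbb{R}^+)}^6 .$$ A minimizer is a $v\in H^1(\mathbb{R}^+)\setminus\{0\}$ with $K_\omega(v)=0$ and $S_\omega(v)=d(\omega)$. *)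

(* Defs.v *)
From HB Require Import structures.
From mathcomp Require Import all_boot all_order all_algebra.
From mathcomp Require Import all_classical all_reals all_analysis.
From mathcomp Require Import complex ring.
Set Implicit Arguments.
Unset Strict Implicit.
Unset Printing Implicit Defensive.
Import Order.TTheory GRing.Theory Num.Theory.
Import numFieldNormedType.Exports.
Local Open Scope classical_set_scope.
Local Open Scope ring_scope.

Section HalfLine.
Variable R : realType.
Implicit Types (u v g : R -> R[i]) (f : R -> R).

Definition Rpos : set R := `]0, +oo[%classic.

Definition Rnneg : set R := `[0, +oo[%classic.

Local Notation mu := (@lebesgue_measure R).

Definition measurable_C v :=
  measurable_fun Rpos (fun x => complex.Re (v x)) /\
  measurable_fun Rpos (fun x => complex.Im (v x)).

Definition LnormC (p : R) v : \bar R :=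
  Lnorm mu p%:E ((fun x => (Normc.normc (v x))%:E) \_ Rpos).

Definition inL2 v := measurable_C v /\ (LnormC 2 v < +oo)%E.

Definition integralC v : R[i] :=
  Complex (Rintegral mu Rpos (fun x => complex.Re (v x)))
          (Rintegral mu Rpos (fun x => complex.Im (v x))).

(* Real-valued test functions of class C^1 with compact support in (0, +oo),
   as in Brezis' definition of Sobolev spaces on an interval; by linearity
   complex-valued ones would define the same weak derivative. *)
Definition test_function f :=
  [/\ forall x, derivable f x 1, continuous (derive1 f),
      compact (closure [set x | f x != 0]) &
      closure [set x | f x != 0] `<=` Rpos].

Definition weak_derivative v g :=
  forall f, test_function f ->
    integralC (fun x => v x * (derive1 f x)%:C%C)
    = - integralC (fun x => g x * (f x)%:C%C).

(* An element of H^1(0, +oo) is represented by its unique representative that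
   is continuous on [0, +oo), so that the trace v(0) is the value at 0, together
   with a version of its weak derivative, which is unique almost everywhere.
   Values on (-oo, 0) carry no information. *)
Record H1 := MkH1 {
  H1_fun :> R -> R[i] ;
  H1_der : R -> R[i] ;
  H1_L2 : inL2 H1_fun ;
  H1_der_L2 : inL2 H1_der ;
  H1_weak_derivative : weak_derivative H1_fun H1_der ;
  H1_continuous :
    {within Rnneg, continuous (fun x : R => complex.Re (H1_fun x))} /\
    {within Rnneg, continuous (fun x : R => complex.Im (H1_fun x))}
}.

Definition H1_nonzero (v : H1) := ~ {ae mu, forall x, Rpos x -> v x = 0}.

(* The L^2 norms below are finite by definition of [H1], and the L^6 norm by
   the embedding of H^1 into L^6; [fine] is thus only a cast. *)
Definition normLp (p : R) v : R := fine (LnormC p v).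

Definition S_fun (alpha omega : R) (v : H1) : R :=
  2^-1 * (normLp 2 (H1_der v) ^+ 2 + omega * normLp 2 v ^+ 2
          + alpha * Normc.normc (v 0) ^+ 2)
  - 32^-1 * normLp 6 v ^+ 6.

Definition K_fun (alpha omega : R) (v : H1) : R :=
  normLp 2 (H1_der v) ^+ 2 + omega * normLp 2 v ^+ 2
  + alpha * Normc.normc (v 0) ^+ 2
  - 3 / 16 * normLp 6 v ^+ 6.

Definition admissible (alpha omega : R) : set H1 :=
  [set v | K_fun alpha omega v = 0 /\ H1_nonzero v].

Definition d_inf (alpha omega : R) : \bar R :=
  ereal_inf [set (S_fun alpha omega v)%:E | v in admissible alpha omega].

Definition minimizer (alpha omega : R) (v : H1) :=
  admissible alpha omega v /\ (S_fun alpha omega v)%:E = d_inf alpha omega.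

Definition sech (x : R) : R := 2 / (expR x + expR (- x)).

Definition tanh (x : R) : R :=
  (expR x - expR (- x)) / (expR x + expR (- x)).

Definition artanh (y : R) : R := 2^-1 * ln ((1 + y) / (1 - y)).

Lemma artanhK (y : R) : -1 < y < 1 -> tanh (artanh y) = y.
Proof.
move=> /andP[y1 y2]; rewrite /tanh /artanh expRN.
have n1 : 0 < 1 - y by rewrite subr_gt0.
have p1 : 0 < 1 + y by rewrite -ltrBlDl sub0r.
set e := expR _.
have e0 : 0 < e by exact: expR_gt0.
have e2 : e * e = (1 + y) / (1 - y).
  rewrite /e -expRD -mulrDl; have -> : 2^-1 + 2^-1 = 1 :> R by field.
  by rewrite mul1r lnK// posrE divr_gt0.
have -> : (e - e^-1) / (e + e^-1) = (e * e - 1) / (e * e + 1).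
  by field; rewrite !gt_eqF ?addr_gt0 ?mulr_gt0.
rewrite e2; field; rewrite gt_eqF//= (_ : _ + _ = 2) ?pnatr_eq0//; ring.
Qed.

Definition phi (alpha omega x : R) : R :=
  2 * omega `^ 4^-1 *
  sech (2 * Num.sqrt omega * `|x| + artanh (- alpha / Num.sqrt omega)) `^ 2^-1.

Definition expi (theta : R) : R[i] := Complex (cos theta) (sin theta).

End HalfLine.

(* Main.v *)
Require Import Defs.
From mathcomp Require Import all_boot all_order all_algebra.
From mathcomp Require Import all_classical all_reals all_analysis.
From mathcomp Require Import measurable_realfun complex ring lra.
Set Implicit Arguments.
Unset Strict Implicit.
Unset Printing Implicit Defensive.
Import Order.TTheory GRing.Theory Num.Theory.
Import numFieldNormedType.Exports.
Local Open Scope classical_set_scope.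
Local Open Scope ring_scope.

(** Where K vanishes, S equals a sixteenth of the sextic integral N6(v), the
    integral of |v|^6.  As the quadratic part Q of K and N6 are homogeneous of
    degrees 2 and 6, a minimizer v satisfies Q(v)^3 N6(w) <= Q(w)^3 N6(v) for
    every w with Q(w) > 0 and N6(w) > 0 ([minimizer_homogeneous]): rescale w
    onto K = 0.  With w = v + t f and f a test function, the two sides agree
    at t = 0, so their first order terms agree, and v solves
    v'' = omega v - (3/16) |v|^4 v weakly ([minimizer_critical]).

    A function with a weak derivative is a primitive of it (the du
    Bois-Reymond lemma, [weak_derivative_primitive]), so v is of class C^2 on
    the open half-line.  Write v = p + i q and N = |v|^2.  The energy
    |v'|^2 - omega N + N^3 / 16 and the momentum p q' - q p' are constant, and
    they are integrable over an infinite half-line, hence both are zero.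
    - Zero energy bounds |N'| by 2 sqrt(omega) N, so that N vanishes nowhere.
    - Zero momentum makes the phase p / sqrt N, q / sqrt N constant.
    - Together they turn the nonlinear equation into the linear one
      (1/N)'' = 4 omega (1/N), with first integral
      ((1/N)')^2 = 4 omega (1/N)^2 - 1/4.  Hence, with k = 2 sqrt(omega),
      1/N = A e^(kx) + B e^(-kx), where A, B > 0 and 64 omega A B = 1
      ([wave_profile]).

    One parameter is left, and the boundary fixes it.  The variations above
    vanish near 0, so they give no boundary condition; the constraint K(v) = 0
    does.  By the equation, the integrand of K is the derivative of N'/2, and N'
    vanishes at infinity, so that the constraint reads
    - N'(0)/2 + alpha N(0) = 0.  For the explicit profile this is
    sqrt(omega) (A - B) = - alpha (A + B) ([minimizer_shape]), which is the
    shift by artanh (- alpha / sqrt omega) in [phi] ([phiE]). *)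

(** * Smooth test functions *)

Section PointwiseDerivatives.
Variable R : realType.
Implicit Types (f g : R -> R) (x a b : R).

(** Pointwise forms of the differentiation rules: unification with a lambda term
    then finds the subfunctions. *)
Lemma is_deriveD_fun f g x a b : is_derive x 1 f a -> is_derive x 1 g b ->
  is_derive x 1 (fun y => f y + g y) (a + b).
Proof. exact: is_deriveD. Qed.

Lemma is_deriveN_fun f x a : is_derive x 1 f a ->
  is_derive x 1 (fun y => - f y) (- a).
Proof. exact: is_deriveN. Qed.

Lemma is_deriveM_fun f g x a b : is_derive x 1 f a -> is_derive x 1 g b ->
  is_derive x 1 (fun y => f y * g y) (a * g x + f x * b).
Proof.
move=> fa gb; have -> : (fun y => f y * g y) = f * g by apply/funext.
apply: is_derive_eq.
by rewrite addrC /GRing.scale /= [g x * a]mulrC.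
Qed.

Lemma is_deriveX_fun f n x a : is_derive x 1 f a ->
  is_derive x 1 (fun y => f y ^+ n) (n%:R * f x ^+ n.-1 * a).
Proof.
move=> fa; have -> : (fun y => f y ^+ n) = f ^+ n.
  by apply/funext => y; rewrite fctE.
by apply: is_derive_eq.
Qed.

Lemma is_derive_comp_fun f g x a b : is_derive (g x) 1 f a -> is_derive x 1 g b ->
  is_derive x 1 (fun y => f (g y)) (a * b).
Proof. exact: is_derive1_comp. Qed.

Lemma is_deriveV_fun f x a : f x != 0 -> is_derive x 1 f a ->
  is_derive x 1 (fun y => (f y)^-1) (- (f x) ^- 2 * a).
Proof.
move=> fx [fa <-]; split; first exact: derivableV.
by rewrite deriveV.
Qed.

Lemma is_derive_cst_fun a x : is_derive x 1 (fun _ : R => a) 0.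
Proof. exact: is_derive_cst. Qed.

Lemma is_derive_id_fun x : is_derive x 1 (fun y : R => y) 1.
Proof. exact: is_derive_id. Qed.

Lemma is_derive_expR_fun f x a : is_derive x 1 f a ->
  is_derive x 1 (fun y => expR (f y)) (expR (f x) * a).
Proof. by move=> ?; apply: is_derive_comp_fun. Qed.

Lemma is_derive_continuous f x a : is_derive x 1 f a -> {for x, continuous f}.
Proof. by move=> [d _]; apply: differentiable_continuous; exact/derivable1_diffP. Qed.

Lemma is_derive_derive1 f x a : is_derive x 1 f a -> derive1 f x = a.
Proof. by move=> fa; rewrite derive1E; apply: derive_val. Qed.

End PointwiseDerivatives.

Ltac derive_eq := notypeclasses refine (is_derive_eq _ _).

(** [notypeclasses] matters: instance search would otherwise close the goals with
    its own expressions for the derivatives.  The extra tactic [tac] comes first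
    so that functions with a known derivative are not unfolded. *)
Ltac derive_with tac := repeat first
  [ eassumption
  | tac
  | notypeclasses refine (is_derive_cst_fun _ _)
  | notypeclasses refine (is_derive_id_fun _)
  | notypeclasses refine (is_deriveX_fun _ _)
  | notypeclasses refine (is_deriveN_fun _)
  | notypeclasses refine (is_deriveM_fun _ _)
  | notypeclasses refine (is_deriveD_fun _ _)
  | notypeclasses refine (is_derive_expR_fun _) ].

Ltac derive_tac := derive_with fail.

Section TestFunctions.
Variable R : realType.
Implicit Types (x y z r s : R).

Let sq z := z * `|z|.

Let is_derive_sq z : is_derive z 1 sq (2 * `|z|).
Proof.
have [z0|z0|->] := ltgtP z 0.
- have e : \forall y \near z, - (y * y) = sq y.
    by near=> y; rewrite /sq ltr0_norm ?mulrN//; near: y; exact: lt_nbhsl.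
  apply: (near_eq_is_derive e).
  derive_eq; first by derive_tac.
  rewrite ltr0_norm//; ring.
- have e : \forall y \near z, y * y = sq y.
    by near=> y; rewrite /sq gtr0_norm//; near: y; exact: lt_nbhsr.
  apply: (near_eq_is_derive e).
  derive_eq; first by derive_tac.
  rewrite gtr0_norm//; ring.
- apply/is_derive1_caratheodory; exists (fun y => `|y|); split.
  + by move=> y; rewrite /sq !(normr0, mul0r, subr0) mulrC.
  + exact: norm_continuous.
  + by rewrite normr0 mulr0.
Unshelve. all: by end_near. Qed.

(** The triangle of height 1 on [-1, 1], as a second difference of the absolute
    value. *)
Definition hat z := (`|z + 1| - 2 * `|z| + `|z - 1|) / 2.

(** A primitive of [hat].  As [z * `|z|] has the continuous derivative [2 * `|z|],
    its second difference is a step from 0 to 1 of class C^1 given by a single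
    formula. *)
Definition ramp z := (sq (z + 1) - 2 * sq z + sq (z - 1)) / 4 + 2^-1.

Lemma is_derive_ramp z : is_derive z 1 ramp (hat z).
Proof.
rewrite /ramp; derive_eq.
  derive_with ltac:(notypeclasses refine (is_derive_comp_fun (is_derive_sq _) _)).
by rewrite /hat; field.
Qed.

Lemma hat_continuous : continuous hat.
Proof.
move=> z; rewrite /hat /continuous_at; apply: cvgMl; apply: cvgD; first apply: cvgB.
- by apply: cvg_norm; apply: cvgD => //; apply: cvg_cst.
- by apply: cvgMr; apply: cvg_norm.
- by apply: cvg_norm; apply: cvgB => //; apply: cvg_cst.
Qed.

Lemma hat_ge0 z : 0 <= hat z.
Proof.
by rewrite /hat; case: (ger0P (z + 1)) => ?; case: (ger0P z) => ?;
  case: (ger0P (z - 1)) => ?; lra.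
Qed.

Lemma hat_le1 z : hat z <= 1.
Proof.
by rewrite /hat; case: (ger0P (z + 1)) => ?; case: (ger0P z) => ?;
  case: (ger0P (z - 1)) => ?; lra.
Qed.

Lemma hat_eq0 z : 1 <= `|z| -> hat z = 0.
Proof.
rewrite ler_normr /hat => /orP[] z1.
- rewrite !ger0_norm; lra.
- rewrite !ler0_norm; lra.
Qed.

Lemma ramp_le z : z <= -1 -> ramp z = 0.
Proof. by move=> z1; rewrite /ramp /sq !ler0_norm; [by field|lra..]. Qed.

Lemma ramp_ge z : 1 <= z -> ramp z = 1.
Proof. by move=> z1; rewrite /ramp /sq !ger0_norm; [by field|lra..]. Qed.

Lemma ramp_homo z s : z <= s -> ramp z <= ramp s.
Proof.
move=> zs; apply: (@ger0_derive1_ndecr _ ramp (z - 1) (s + 1)); [| | |lra|exact: zs|lra].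
- by move=> y _; have [] := is_derive_ramp y.
- by move=> y _; rewrite (is_derive_derive1 (is_derive_ramp y)) hat_ge0.
- apply: continuous_subspaceT => y; exact: is_derive_continuous (is_derive_ramp y).
Qed.

Lemma ramp_ge0 z : 0 <= ramp z.
Proof.
have [z1|z1] := leP z (-1); first by rewrite ramp_le.
by rewrite -(ramp_le (lexx _)) ramp_homo// ltW.
Qed.

Lemma ramp_le1 z : ramp z <= 1.
Proof.
have [z1|z1] := leP 1 z; first by rewrite ramp_ge.
by rewrite -(ramp_ge (lexx _)) ramp_homo// ltW.
Qed.

(** The support [x, x + 2r] lies to the right of [x].  For [x > 0] it thus
    stays inside the half-line for every [r], and the steps below converge to the indicator of
    ]x, +oo[ at every point, including [x]. *)
Definition mollifier x r s := hat ((s - x) / r - 1) / r.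

Definition smooth_step x r s := ramp ((s - x) / r - 1).

Definition plateau x y r s := smooth_step x r s - smooth_step y r s.

Lemma is_derive_step x r s : is_derive s 1 (smooth_step x r) (mollifier x r s).
Proof.
rewrite /smooth_step; derive_eq.
  derive_with ltac:(notypeclasses refine (is_derive_comp_fun (is_derive_ramp _) _)).
rewrite /mollifier /=; ring.
Qed.

Lemma mollifier_continuous x r : continuous (mollifier x r).
Proof.
move=> s; rewrite /mollifier /continuous_at; apply: cvgMl.
apply: (@cvg_comp _ _ _ (fun s => (s - x) / r - 1) hat); last exact: hat_continuous.
by apply: cvgB; [apply: cvgMl; apply: cvgB|]; first [exact: cvg_id|exact: cvg_cst].
Qed.

Lemma mollifier_ge0 x r s : 0 < r -> 0 <= mollifier x r s.
Proof. by move=> r0; rewrite divr_ge0 ?hat_ge0// ltW. Qed.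

Lemma mollifier_le x r s : 0 < r -> mollifier x r s <= r^-1.
Proof. by move=> r0; rewrite /mollifier ler_piMl ?hat_le1// invr_ge0 ltW. Qed.

Lemma mollifier_eq0 x r s : 0 < r -> (s <= x) || (x + 2 * r <= s) -> mollifier x r s = 0.
Proof.
move=> r0 h; rewrite /mollifier hat_eq0 ?mul0r// ler_normr.
case/orP: h => h; apply/orP; [right|left].
- have : (s - x) / r <= 0 by rewrite pmulr_lle0 ?invr_gt0//; lra.
  by move: (_ / r) => t; lra.
- have : 2 <= (s - x) / r by rewrite ler_pdivlMr//; lra.
  by move: (_ / r) => t; lra.
Qed.

Lemma smooth_step_le x r s : 0 < r -> s <= x -> smooth_step x r s = 0.
Proof.
move=> r0 h; rewrite /smooth_step ramp_le//.
have : (s - x) / r <= 0 by rewrite pmulr_lle0 ?invr_gt0//; lra.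
by move: (_ / r) => t; lra.
Qed.

Lemma smooth_step_ge x r s : 0 < r -> x + 2 * r <= s -> smooth_step x r s = 1.
Proof.
move=> r0 h; rewrite /smooth_step ramp_ge//.
have : 2 <= (s - x) / r by rewrite ler_pdivlMr//; lra.
by move: (_ / r) => t; lra.
Qed.

Lemma is_derive_plateau x y r s :
  is_derive s 1 (plateau x y r) (mollifier x r s - mollifier y r s).
Proof.
apply: is_deriveD_fun; first exact: is_derive_step.
by apply: is_deriveN_fun; exact: is_derive_step.
Qed.

Lemma derive1_plateau x y r :
  derive1 (plateau x y r) = (fun s => mollifier x r s - mollifier y r s).
Proof. by apply/funext => s; exact: is_derive_derive1 (is_derive_plateau _ _ _ _). Qed.

Lemma plateau_eq0 x y r s : 0 < r -> x <= y -> (s <= x) || (y + 2 * r <= s) ->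
  plateau x y r s = 0.
Proof.
move=> r0 xy /orP[h|h]; rewrite /plateau.
- by rewrite !smooth_step_le//; lra.
- by rewrite !smooth_step_ge//; lra.
Qed.

Lemma plateau_le1 x y r s : `|plateau x y r s| <= 1.
Proof.
rewrite /plateau /smooth_step ler_norml; move: (ramp_ge0 ((s - x) / r - 1))
 (ramp_ge0 ((s - y) / r - 1)) (ramp_le1 ((s - x) / r - 1)) (ramp_le1 ((s - y) / r - 1)).
by lra.
Qed.

Lemma test_function_supported (f : R -> R) a b : 0 < a ->
  (forall s, (s < a) || (b < s) -> f s = 0) ->
  compact (closure [set s | f s != 0]) /\ closure [set s | f s != 0] `<=` @Rpos R.
Proof.
move=> a0 f0.
have sub : closure [set s | f s != 0] `<=` `[a, b].
  have -> : [set` `[a, b]] = closure [set` `[a, b]] by apply/closure_id/itv_closed.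
  apply: closure_subset => s /= fs; rewrite in_itv/= !leNgt -negb_or.
  by apply: contra fs => /f0 ->.
split.
  apply: (subclosed_compact _ (@segment_compact _ a b)) => //; exact: closed_closure.
move=> s /sub; rewrite /Rpos /= !in_itv/= => /andP[as_ _].
by rewrite (lt_le_trans a0 as_).
Qed.

Lemma plateau_test x y r : 0 < x -> x <= y -> 0 < r ->
  test_function (plateau x y r).
Proof.
move=> x0 xy r0.
have [c1 c2] : compact (closure [set s | plateau x y r s != 0]) /\
  closure [set s | plateau x y r s != 0] `<=` @Rpos R.
  apply: (@test_function_supported _ x (y + 2 * r)) => // s h.
  by rewrite plateau_eq0//; case/orP: h => /ltW ->; rewrite ?orbT.
split; [| |exact: c1|exact: c2].
- by move=> s; have [] := is_derive_plateau x y r s.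
- by rewrite derive1_plateau => s; apply: cvgB; exact: mollifier_continuous.
Qed.

End TestFunctions.

(** * Integration on the half-line *)

Section Integration.
Variable R : realType.
Implicit Types (f g h : R -> R) (x y z r s : R).
Local Notation mu := (@lebesgue_measure R).
Local Notation Rpos := (@Rpos R).

Definition integrable_pos f : Prop := mu.-integrable Rpos (EFin \o f).

Definition sqr_integrable f : Prop := measurable_fun Rpos f /\ integrable_pos (fun x => f x ^+ 2).

Definition int_pos f := Rintegral mu Rpos f.

Lemma RposE x : Rpos x = (0 < x) :> Prop.
Proof. by rewrite /Defs.Rpos /= in_itv/= andbT. Qed.

(** The sigma-algebra that carries the Lebesgue measure is convertible to the
    default one on [R], which unification does not see. *)
Lemma measurable_itv_lebesgue (i : interval R) :
  measurable ([set` i] : set (measurableTypeR R)).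
Proof. exact: measurable_itv. Qed.

Lemma measurable_Rpos : measurable (Rpos : set (measurableTypeR R)).
Proof. exact: measurable_itv. Qed.
Hint Resolve measurable_Rpos : core.

Lemma integrable_pos_measurable f : integrable_pos f -> measurable_fun Rpos f.
Proof. by rewrite /integrable_pos => /integrableP[/measurable_EFinP]. Qed.

Lemma integrable_pos_le f g : measurable_fun Rpos f -> integrable_pos g ->
  (forall x, 0 < x -> `|f x| <= g x) -> integrable_pos f.
Proof.
rewrite /integrable_pos => mf ig fg; apply: (le_integrable measurable_Rpos _ _ ig).
  exact/measurable_EFinP.
move=> x; rewrite RposE => /fg /= fgx.
by rewrite lee_fin (le_trans fgx)// ler_norm.
Qed.

Lemma eq_integrable_pos f g : (forall x, 0 < x -> f x = g x) -> integrable_pos f -> integrable_pos g.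
Proof.
move=> fg; apply: eq_integrable => // x; rewrite inE RposE /= => x0.
by rewrite fg.
Qed.

Lemma integrable_posD f g : integrable_pos f -> integrable_pos g -> integrable_pos (fun x => f x + g x).
Proof. exact: (@integrableD _ _ _ mu _ measurable_Rpos (EFin \o f) (EFin \o g)). Qed.

Lemma integrable_posZ (k : R) f : integrable_pos f -> integrable_pos (fun x => k * f x).
Proof. exact: (@integrableZl _ _ _ mu _ measurable_Rpos k (EFin \o f)). Qed.

Lemma integrable_posB f g : integrable_pos f -> integrable_pos g -> integrable_pos (fun x => f x - g x).
Proof. exact: (@integrableB _ _ _ mu _ measurable_Rpos (EFin \o f) (EFin \o g)). Qed.

Lemma integrable_pos_norm f : integrable_pos f -> integrable_pos (fun x => `|f x|).
Proof. exact: (@integrable_norm _ _ _ mu Rpos f). Qed.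

Lemma eq_int_pos f g : (forall x, 0 < x -> f x = g x) -> int_pos f = int_pos g.
Proof.
by move=> fg; apply: eq_Rintegral => x; rewrite inE RposE => /fg.
Qed.

Lemma int_posD f g : integrable_pos f -> integrable_pos g ->
  int_pos (fun x => f x + g x) = int_pos f + int_pos g.
Proof. exact: RintegralD. Qed.

Lemma int_posB f g : integrable_pos f -> integrable_pos g ->
  int_pos (fun x => f x - g x) = int_pos f - int_pos g.
Proof. exact: RintegralB. Qed.

Lemma int_posZ (k : R) f : integrable_pos f -> int_pos (fun x => k * f x) = k * int_pos f.
Proof. exact: RintegralZl. Qed.

Lemma int_pos_ge0 f : (forall x, 0 < x -> 0 <= f x) -> 0 <= int_pos f.
Proof. by move=> f0; apply: Rintegral_ge0 => x; rewrite RposE => /f0. Qed.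

Lemma le_int_pos f g : integrable_pos f -> integrable_pos g -> (forall x, 0 < x -> f x <= g x) ->
  int_pos f <= int_pos g.
Proof.
by move=> ? ? fg; apply: le_Rintegral => // x; rewrite RposE => /fg.
Qed.

Lemma int_pos_ae f g : measurable_fun Rpos f -> measurable_fun Rpos g ->
  {ae mu, forall x, Rpos x -> f x = g x} -> int_pos f = int_pos g.
Proof.
move=> mf mg fg; congr fine; apply: ae_eq_integral => //.
- exact/measurable_EFinP.
- exact/measurable_EFinP.
- case: fg => N [mN N0 sub]; exists N; split => // x nx; apply: sub => fgx.
  by apply: nx => /fgx /= ->.
Qed.

(** By |ab| <= a^2 + b^2. *)
Lemma integrable_posM f g : sqr_integrable f -> sqr_integrable g -> integrable_pos (fun x => f x * g x).
Proof.
move=> [mf f2] [mg g2]; apply: (integrable_pos_le _ (integrable_posD f2 g2)).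
  exact: measurable_funM.
move=> x _; rewrite normrM -[f x ^+ 2]real_normK ?num_real//.
rewrite -[g x ^+ 2]real_normK ?num_real//.
by move: (`|f x|) (`|g x|) => a b; have := sqr_ge0 (a - b);
  have := sqr_ge0 a; have := sqr_ge0 b; nra.
Qed.

Lemma sqr_integrableZ (k : R) f : sqr_integrable f -> sqr_integrable (fun x => k * f x).
Proof.
move=> [mf f2]; split; first exact: measurable_funM.
by apply: eq_integrable_pos (integrable_posZ (k ^+ 2) f2) => x _; rewrite exprMn.
Qed.

Lemma sqr_integrableD f g : sqr_integrable f -> sqr_integrable g -> sqr_integrable (fun x => f x + g x).
Proof.
move=> Lf Lg; have Lfg := integrable_posM Lf Lg; case: Lf Lg => mf f2 [mg g2].
split; first exact: measurable_funD.
by apply: eq_integrable_pos (integrable_posD (integrable_posD f2 g2) (integrable_posZ 2 Lfg)) => x _; ring.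
Qed.

Lemma integrable_posM_bounded f g (M : R) : measurable_fun Rpos f ->
  (forall x, 0 < x -> `|f x| <= M) -> integrable_pos g -> integrable_pos (fun x => f x * g x).
Proof.
move=> mf fM ig.
have ing := integrable_pos_norm ig.
apply: (integrable_pos_le _ (integrable_posZ M ing)).
  by apply: measurable_funM => //; exact: integrable_pos_measurable.
by move=> x x0; rewrite normrM ler_wpM2r// fM.
Qed.

Lemma sqr_integrableM_bounded f g (M : R) : measurable_fun Rpos f ->
  (forall x, 0 < x -> `|f x| <= M) -> sqr_integrable g -> sqr_integrable (fun x => f x * g x).
Proof.
move=> mf fM [mg g2]; split; first exact: measurable_funM.
apply: (@eq_integrable_pos (fun x => f x ^+ 2 * g x ^+ 2)); first by move=> x _; rewrite exprMn.
apply: (@integrable_posM_bounded _ _ (M ^+ 2)) => //; first exact: measurable_funX.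
move=> x /fM fxM; rewrite normrX lerXn2r// ?nnegrE//.
by rewrite (le_trans _ fxM).
Qed.

Lemma sqr_integrable_itv f b : sqr_integrable f -> mu.-integrable `]0, b] (EFin \o f).
Proof.
move=> [mf f2].
have sub : `]0, b] `<=` Rpos.
  by move=> x /=; rewrite RposE in_itv/= => /andP[].
have i1 : mu.-integrable `]0, b] (EFin \o (fun x => f x ^+ 2 + 1)).
  have := @integrableD _ _ _ mu _ (measurable_itv_lebesgue `]0, b])
     (EFin \o (fun x => f x ^+ 2)) (EFin \o cst 1); apply.
    exact: integrableS f2.
  apply: measurable_bounded_integrable => //.
    rewrite [ltLHS](lebesgue_measure_itv `]0, b]) /=.
    by case: ifP => _; rewrite ?ltry// -EFinD ltry.
  by exists 1; split => // x x1 t _ /=; rewrite normr1 ltW.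
apply: (le_integrable (measurable_itv_lebesgue _) _ _ i1) => /=.
  by apply/measurable_EFinP; exact: measurable_funS mf.
move=> x _; rewrite lee_fin [leRHS]ger0_norm ?addr_ge0 ?sqr_ge0//.
rewrite -[f x ^+ 2]real_normK ?num_real//.
by move: (`|f x|) => a; have := sqr_ge0 (a - 1); have := sqr_ge0 a; nra.
Qed.

(** Dominated convergence when only a bounded weight varies. *)
Lemma int_pos_dominated f (h_ : nat -> R -> R) h : integrable_pos f ->
  (forall n, measurable_fun Rpos (h_ n)) -> measurable_fun Rpos h ->
  (forall n x, `|h_ n x| <= 1) ->
  (forall x, 0 < x -> h_ n x @[n --> \oo] --> h x) ->
  int_pos (fun x => f x * h_ n x) @[n --> \oo] --> int_pos (fun x => f x * h x).
Proof.
move=> fi mh_ mh h1 hh.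
have mf := integrable_pos_measurable fi.
have inf := integrable_pos_norm fi.
have [] := @dominated_convergence _ _ R mu Rpos measurable_Rpos
  (fun n x => (f x * h_ n x)%:E) (fun x => (f x * h x)%:E) (fun x => `|f x|%:E).
- by move=> n; apply/measurable_EFinP; exact: (measurable_funM mf (mh_ n)).
- by apply/measurable_EFinP; exact: (measurable_funM mf mh).
- apply: aeW => x; rewrite RposE => x0; apply/cvg_EFin; first exact: nearW.
  by apply: cvgMr; exact: hh.
- exact: inf.
- apply: aeW => x n _; rewrite lee_fin normrM ler_piMr//.
- move=> ifh _ c; apply: fine_cvg; rewrite fineK; last first.
    exact: (integrable_fin_num measurable_Rpos ifh).
  exact: c.
Qed.

End Integration.

Arguments measurable_Rpos {R}.
Arguments measurable_itv_lebesgue {R}.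

(** * Weak derivatives are classical at Lebesgue points *)

Section WeakDerivative.
Variable R : realType.
Implicit Types (f g h u : R -> R) (x y z r s : R).
Local Notation mu := (@lebesgue_measure R).
Local Notation Rpos := (@Rpos R).
Hint Resolve measurable_Rpos : core.

Lemma integrable_pos_bounded_support h b M : measurable_fun Rpos h ->
  (forall x, `|h x| <= M) -> (forall x, b < x -> h x = 0) -> integrable_pos h.
Proof.
move=> mh hM h0.
have i1 : integrable_pos (\1_[set` `]0, b]]).
  rewrite /integrable_pos; apply: (@integrableS _ _ _ mu setT Rpos) => //.
  exact: integrable_indic_itv.
apply: (integrable_pos_le mh (integrable_posZ M i1)) => x x0; rewrite indicE mem_setE.
have [xb|bx] := leP x b; first by rewrite in_itv/= x0 xb mulr1.
by rewrite h0// normr0 in_itv/= x0 [x <= b]leNgt bx mulr0.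
Qed.

Lemma sqr_integrable_bounded_support h b M : measurable_fun Rpos h ->
  (forall x, `|h x| <= M) -> (forall x, b < x -> h x = 0) -> sqr_integrable h.
Proof.
move=> mh hM h0; split => //; apply: (@integrable_pos_bounded_support _ b (M ^+ 2)).
- exact: measurable_funX.
- by move=> x; rewrite normrX lerXn2r ?nnegrE// (le_trans _ (hM x)).
- by move=> x /h0 ->; rewrite expr0n.
Qed.

Lemma continuous_measurable_Rpos h : continuous h -> measurable_fun Rpos h.
Proof.
by move=> ch; apply: measurable_funTS; exact: continuous_measurable_fun.
Qed.

Lemma int_pos_support f (i : interval R) : [set` i] `<=` Rpos ->
  (forall x, 0 < x -> x \notin i -> f x = 0) ->
  int_pos f = Rintegral mu [set` i] f.
Proof.
move=> iR f0; rewrite /int_pos Rintegral_mkcond [RHS]Rintegral_mkcond.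
apply: eq_Rintegral => x _; rewrite !patchE.
case: ifPn => xR; case: ifPn => xi //.
  by apply: f0; [rewrite -RposE; exact: set_mem|move: xi; rewrite mem_setE].
by move: xR; rewrite (mem_set (iR _ (set_mem xi))).
Qed.

(** Differentiability on the whole line supplies the one-sided limits of [F] at
    the end points. *)
Lemma Rintegral_FTC2 F f a b : a < b -> (forall x, is_derive x 1 F (f x)) ->
  continuous f -> Rintegral mu `[a, b] f = F b - F a.
Proof.
move=> ab dF cf; rewrite /Rintegral (@continuous_FTC2 _ f F)//.
- exact: continuous_subspaceT.
- have cF x : {for x, continuous F} by exact: is_derive_continuous (dF x).
  split; first by move=> x _; have [] := dF x.
  + by apply: cvg_at_right_filter; exact: cF.
  + by apply: cvg_at_left_filter; exact: cF.
- by move=> x _; exact: is_derive_derive1 (dF x).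
Qed.

Lemma measurable_patch_Rpos f :
  measurable_fun Rpos f -> measurable_fun setT (f \_ Rpos).
Proof. by move=> mf; apply/(measurable_restrictT f _) => //; exact: measurable_itv. Qed.

Lemma measurable_mollifier x r : measurable_fun Rpos (mollifier x r).
Proof. by apply: continuous_measurable_Rpos; exact: mollifier_continuous. Qed.

Lemma integrable_pos_mollifier x r : 0 < r -> integrable_pos (mollifier x r).
Proof.
move=> r0; apply: (@integrable_pos_bounded_support _ (x + 2 * r) r^-1).
- exact: measurable_mollifier.
- by move=> s; rewrite ger0_norm ?mollifier_ge0 ?mollifier_le//.
- by move=> s h; rewrite mollifier_eq0// (ltW h) orbT.
Qed.

Lemma sqr_integrable_mollifier x r : 0 < r -> sqr_integrable (mollifier x r).
Proof.
move=> r0; apply: (@sqr_integrable_bounded_support _ (x + 2 * r) r^-1).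
- exact: measurable_mollifier.
- by move=> s; rewrite ger0_norm ?mollifier_ge0 ?mollifier_le//.
- by move=> s h; rewrite mollifier_eq0// (ltW h) orbT.
Qed.

Lemma int_mollifier x r : 0 < x -> 0 < r -> int_pos (mollifier x r) = 1.
Proof.
move=> x0 r0; rewrite (@int_pos_support _ `[x, x + 2 * r]).
- have xr : x < x + 2 * r by lra.
  rewrite (Rintegral_FTC2 xr (is_derive_step x r) (@mollifier_continuous _ x r)).
  by rewrite smooth_step_ge// smooth_step_le// subr0.
- by move=> s /=; rewrite RposE in_itv/= => /andP[xs _]; rewrite (lt_le_trans x0).
- move=> s _; rewrite in_itv/= negb_and -!ltNge => h; rewrite mollifier_eq0//.
  by case/orP: h => /ltW ->; rewrite ?orbT.
Qed.

Lemma sqr_integrable_locally_integrable u : sqr_integrable u ->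
  locally_integrable setT (u \_ Rpos).
Proof.
move=> Lu; have [mu' _] := Lu; split.
- exact: measurable_patch_Rpos.
- exact: openT.
- move=> K _ cK.
  have [M [Mr KM]] := compact_bounded cK.
  pose B := `|M| + 1.
  have KB : K `<=` `[- B, B].
    move=> x Kx; rewrite /= in_itv/= -ler_norml; apply: KM => //.
    by rewrite /B (le_lt_trans (ler_norm M))// ltrDl.
  have iB : mu.-integrable `[- B, B] (EFin \o (u \_ Rpos)).
    rewrite -restrict_EFin.
    apply/(integrable_restrict _ (measurable_itv_lebesgue _)).
      exact: measurable_itv_lebesgue.
        apply: (integrableS (measurable_itv_lebesgue `]0, B]) _ _ (sqr_integrable_itv B Lu)).
      by apply: measurableI; [exact: measurable_itv_lebesgue|].
    by move=> x [/=]; rewrite !in_itv/= andbT => /andP[_ ->] ->.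
  have /integrableP[_] := iB; apply: le_lt_trans.
  apply: ge0_subset_integral => //.
  + exact: compact_measurable.
  + apply/measurable_EFinP; apply: measurableT_comp => //.
    by apply/measurable_EFinP; exact: measurable_int iB.
Qed.

Lemma sqr_integrable_lebesgue_pt u : sqr_integrable u ->
  {ae mu, forall x, lebesgue_pt (u \_ Rpos) x}.
Proof. by move=> /sqr_integrable_locally_integrable; exact: lebesgue_differentiation. Qed.

(** The mollifier is at most 1/r and lives in a ball of length 4r, so that its
    mean of |u - u x| is at most four times the mean over that ball, which is the
    quantity that tends to zero at a Lebesgue point. *)
Lemma mollifier_mean_le u x r : sqr_integrable u -> 2 * r < x -> 0 < r ->
  (`|int_pos (fun s => u s * mollifier x r s) - u x|%:E
    <= 4%:E * davg (u \_ Rpos) x (2 * r))%E.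
Proof.
move=> Lu rx r0.
have x0 : 0 < x by apply: lt_trans rx; rewrite mulr_gt0.
have Lb := sqr_integrable_mollifier x r0; have Lub := integrable_posM Lu Lb.
have L1 := integrable_pos_mollifier x r0.
pose F s := u s * mollifier x r s - u x * mollifier x r s.
have LF : integrable_pos F by apply: integrable_posB => //; exact: integrable_posZ.
have -> : int_pos (fun s => u s * mollifier x r s) - u x = int_pos F.
  by rewrite int_posB//; [rewrite int_posZ// int_mollifier// mulr1|exact: integrable_posZ].
have ballpos s : ball x (2 * r) s -> Rpos s.
  by rewrite ball_itv /= in_itv/= RposE => /andP[+ _]; apply: lt_trans; lra.
have F0 s : ~ ball x (2 * r) s -> F s = 0.
  rewrite ball_itv /= in_itv/= => /negP; rewrite negb_and -!leNgt => h.
  have b0 : mollifier x r s = 0.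
    rewrite mollifier_eq0//; case/orP: h => h; apply/orP; [left|right] => //.
    by apply: (le_trans h); lra.
  by rewrite /F b0 !mulr0 subr0.
have mball : measurable (ball x (2 * r) : set (measurableTypeR R)).
  by rewrite ball_itv; exact: measurable_itv_lebesgue.
rewrite /int_pos (EFin_normr_Rintegral measurable_Rpos LF).
apply: (le_trans (le_abse_integral _ measurable_Rpos _)).
  by apply/measurable_EFinP; exact: integrable_pos_measurable LF.
have -> : (\int[mu]_(s in Rpos) `|(F s)%:E| =
    \int[mu]_(s in ball x (2 * r)) `|(F s)%:E|)%E.
  rewrite integral_mkcond [RHS]integral_mkcond; apply: eq_integral => s _.
  rewrite !patchE; case: ifPn => sR; case: ifPn => sb //.
    by rewrite F0 ?abse0// => /mem_set; exact/negP.
  by move: sR; rewrite (mem_set (ballpos _ (set_mem sb))).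
have mu0 : measurable_fun (ball x (2 * r)) (u \_ Rpos).
  by apply: measurable_funTS; exact: (measurable_patch_Rpos Lu.1).
have md : measurable_fun (ball x (2 * r))
    (fun s => r^-1 * `|(u \_ Rpos) s - (u \_ Rpos) x|).
  apply: measurable_funM => //; apply: measurableT_comp => //.
  exact: measurable_funB.
apply: (@le_trans _ _ (\int[mu]_(s in ball x (2 * r))
   (r^-1%:E * `|((u \_ Rpos) s - (u \_ Rpos) x)%:E|)))%E.
  apply: ge0_le_integral => //.
  - apply: measurableT_comp => //; apply/measurable_EFinP.
    by apply: (measurable_funS measurable_Rpos _ (integrable_pos_measurable LF)).
  - by move/measurable_EFinP : md; exact.
  - move=> s sb; rewrite !patchE (mem_set (ballpos _ sb)).
    have -> : x \in Rpos by apply: mem_set; rewrite RposE.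
    rewrite /F -mulrBl /= -EFinM lee_fin normrM mulrC ler_wpM2r//.
    by rewrite ger0_norm ?mollifier_ge0 ?mollifier_le//.
rewrite ge0_integralZl//; last 2 first.
  - apply: measurableT_comp => //; apply/measurable_EFinP; exact: measurable_funB.
  - by rewrite lee_fin invr_ge0 ltW.
rewrite /davg /iavg /= lebesgue_measure_ball; last first.
  by apply: mulr_ge0 => //; exact: ltW.
have r20 : (2 * r) *+ 2 != 0 by rewrite mulrn_eq0/= mulf_neq0 ?pnatr_eq0 ?gt_eqF.
rewrite inver (negbTE r20) muleA -EFinM.
have -> : 4 * ((2 * r) *+ 2)^-1 = r^-1 by rewrite -mulr_natr; field; rewrite gt_eqF.
exact: lexx.
Qed.

Lemma harmonic_at_right (k : R) : 0 < k ->
  (fun n => k * harmonic n) @ \oo --> (0 : R)^'+.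
Proof.
move=> k0 A [e /= e0 eA].
have c : (fun n => k * harmonic n) @ \oo --> (0 : R).
  by rewrite -[X in _ --> X](mulr0 k); apply: cvgMr; exact: cvg_harmonic.
have /cvgrPdist_lt/(_ _ e0) := c.
apply: filterS => n /= dn; apply: eA => //=.
by rewrite mulr_gt0// harmonic_gt0.
Qed.

Lemma near_harmonic (e : R) : 0 < e -> \forall n \near \oo, 2 * harmonic n < e.
Proof.
move=> e0; have c : (fun n => 2 * harmonic n) @ \oo --> (0 : R).
  by rewrite -[X in _ --> X](mulr0 2); apply: cvgMr; exact: cvg_harmonic.
have /cvgr0Pnorm_lt/(_ _ e0) := c; apply: filterS => n.
by rewrite ger0_norm// mulr_ge0// harmonic_ge0.
Qed.

Lemma mollifier_mean_cvg u x : sqr_integrable u -> 0 < x -> lebesgue_pt (u \_ Rpos) x ->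
  int_pos (fun s => u s * mollifier x (harmonic n) s) @[n --> \oo] --> u x.
Proof.
move=> Lu x0 lx.
have d0 : (4%:E * davg (u \_ Rpos) x (2 * harmonic n))%E @[n --> \oo] --> 0%E.
  rewrite -[X in _ --> X](mule0 4%:E); apply: cvgeZl => //.
  exact: (cvg_comp _ _ (harmonic_at_right (ltr0Sn R 1)) lx).
have e0 : `|int_pos (fun s => u s * mollifier x (harmonic n) s) - u x|%:E
    @[n --> \oo] --> 0%E.
  apply: (squeeze_cvge _ (cvg_cst _) d0).
  have := near_harmonic x0; apply: filterS => n nx.
  apply/andP; split; first by rewrite lee_fin.
  by apply: mollifier_mean_le => //; exact: harmonic_gt0.
by apply/subr_cvg0/norm_cvg0P; move/fine_cvg : e0; exact.
Qed.

Lemma smooth_step_cvg x s :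
  smooth_step x (harmonic n) s @[n --> \oo] --> ((x < s)%R%:R : R).
Proof.
have [xs|sx] := ltP x s; last first.
  by apply: cvg_near_cst; apply: nearW => n; rewrite smooth_step_le// harmonic_gt0.
apply: cvg_near_cst.
have sx0 : 0 < s - x by rewrite subr_gt0.
have := near_harmonic sx0; apply: filterS => n nx.
by rewrite smooth_step_ge ?harmonic_gt0//; lra.
Qed.

(** Plateaus determine weak derivatives.  The derivative of a plateau is a
    difference of two mollifiers, hence an approximate difference of two point
    evaluations. *)
Definition weak_on_plateaus u g := forall x y r, 0 < x -> x < y -> 0 < r ->
  int_pos (fun s => u s * (mollifier x r s - mollifier y r s)) =
  - int_pos (fun s => g s * plateau x y r s).

(** As the width tends to 0, the integral against the derivative of the plateau
    tends to [u x - u y], while the plateau tends to the indicator of ]x, y]. *)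
Lemma weak_derivative_increment u g x y : sqr_integrable u -> sqr_integrable g ->
  weak_on_plateaus u g ->
  0 < x -> x < y -> lebesgue_pt (u \_ Rpos) x -> lebesgue_pt (u \_ Rpos) y ->
  u y - u x = Rintegral mu `]x, y] g.
Proof.
move=> Lu Lg weak x0 xy lx ly; have y0 := lt_trans x0 xy.
(* [g] is only square integrable: cut off, it dominates the sequence. *)
pose gx s := g s * \1_[set` `]0, y + 2]] s.
have Lgx : integrable_pos gx.
  apply: integrable_posM => //; apply: (@sqr_integrable_bounded_support _ (y + 2) 1).
  - by apply: measurable_indic; exact: measurable_itv.
  - by move=> s; rewrite indicE; case: (_ \in _); rewrite ?normr1 ?normr0.
  - by move=> s ys; rewrite indicE mem_setE in_itv/= [s <= _]leNgt ys andbF.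
have c1 : int_pos (fun s => gx s * plateau x y (harmonic n) s) @[n --> \oo]
    --> int_pos (fun s => gx s * ((x < s)%R%:R - (y < s)%R%:R)).
  apply: int_pos_dominated => //.
  - move=> n; apply: continuous_measurable_Rpos => s.
    exact: is_derive_continuous (is_derive_plateau x y _ s).
  - have mi z : measurable_fun Rpos (fun s => (z < s)%R%:R : R).
      have -> : (fun s => (z < s)%R%:R : R) = \1_[set` `]z, +oo[].
        by apply/funext => s; rewrite indicE mem_setE in_itv/= andbT.
      by apply: measurable_indic; exact: measurable_itv.
    exact: measurable_funB.
  - by move=> n s; exact: plateau_le1.
  - by move=> s _; apply: cvgB; exact: smooth_step_cvg.
have c2 : int_pos (fun s => gx s * plateau x y (harmonic n) s) @[n --> \oo]
    --> u y - u x.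
  have -> : (fun n => int_pos (fun s => gx s * plateau x y (harmonic n) s)) =
    (fun n => int_pos (fun s => u s * mollifier y (harmonic n) s) -
              int_pos (fun s => u s * mollifier x (harmonic n) s)).
    apply/funext => n; have r0 := @harmonic_gt0 R n.
    have := weak _ _ _ x0 xy r0.
    rewrite (@eq_int_pos _ _ (fun s => u s * mollifier x (harmonic n) s -
      u s * mollifier y (harmonic n) s)); last by move=> s _; rewrite mulrBr.
    rewrite int_posB; [|exact: integrable_posM Lu (sqr_integrable_mollifier _ r0)..].
    rewrite (@eq_int_pos _ (fun s => g s * _) (fun s => gx s * plateau x y (harmonic n) s)).
      by move=> e; rewrite -[LHS]opprK -e opprB.
    move=> s s0; rewrite /gx indicE mem_setE in_itv/= s0/=.
    have [_|ys] := leP s (y + 2); first by rewrite mulr1.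
    rewrite plateau_eq0 ?mulr0 ?(ltW xy)//; apply/orP; right.
    apply: le_trans (ltW ys); rewrite lerD2l ler_piMr//.
    by rewrite invf_le1// ler1n.
  by apply: cvgB; apply: mollifier_mean_cvg.
have -> : u y - u x = int_pos (fun s => gx s * ((x < s)%R%:R - (y < s)%R%:R)).
  exact: (cvg_unique _ c2 c1).
rewrite (@int_pos_support _ `]x, y]).
- apply: eq_Rintegral => s; rewrite inE /= in_itv/= => /andP[xs sy].
  rewrite /gx indicE mem_setE in_itv/= xs (lt_trans x0 xs) (le_trans sy) ?lerDl//=.
  by rewrite ltNge sy subr0 !mulr1.
- by move=> s /=; rewrite RposE in_itv/= => /andP[/(lt_trans x0)].
- move=> s s0; rewrite in_itv/= negb_and -leNgt -ltNge => /orP[sx|ys].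
  + by rewrite !ltNge sx (le_trans sx (ltW xy)) subrr mulr0.
  + by rewrite ys (lt_trans xy ys) subrr mulr0.
Qed.

Definition primitive g x := Rintegral mu `]0, x] g.

Lemma primitiveB g x y : sqr_integrable g -> 0 < x -> x < y ->
  Rintegral mu `]x, y] g = primitive g y - primitive g x.
Proof.
move=> Lg x0 xy; rewrite /primitive Rintegral_itvB ?bnd_simp ?ltW//.
exact: sqr_integrable_itv.
Qed.

(** The du Bois-Reymond lemma.  The restriction to Lebesgue points is there because
    the hypothesis does not see changes of [u] on null sets; every point of
    continuity is one ([continuous_Lebesgue_pt]). *)
Lemma weak_derivative_primitive u g : sqr_integrable u -> sqr_integrable g ->
  weak_on_plateaus u g ->
  exists c, forall x, 0 < x -> lebesgue_pt (u \_ Rpos) x -> u x = c + primitive g x.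
Proof.
move=> Lu Lg weak.
have inc x y : 0 < x -> 0 < y -> lebesgue_pt (u \_ Rpos) x ->
  lebesgue_pt (u \_ Rpos) y -> u x - primitive g x = u y - primitive g y.
  move=> x0 y0 lx ly; have [xy|yx|->//] := ltgtP x y.
  - have := weak_derivative_increment Lu Lg weak x0 xy lx ly.
    by rewrite primitiveB//; lra.
  - have := weak_derivative_increment Lu Lg weak y0 yx ly lx.
    by rewrite primitiveB//; lra.
have [[x [x0 lx]]|none] := pselect (exists x, 0 < x /\ lebesgue_pt (u \_ Rpos) x).
- by exists (u x - primitive g x) => y y0 ly; rewrite (inc x y)// subrK.
- by exists 0 => x x0 lx; exfalso; apply: none; exists x.
Qed.

Lemma continuous_Lebesgue_pt u x : measurable_fun Rpos u -> 0 < x ->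
  {for x, continuous u} -> lebesgue_pt (u \_ Rpos) x.
Proof.
move=> mu' x0 cu; have oR : open Rpos by exact: interval_open.
have nR : open_nbhs x Rpos by split => //; rewrite RposE.
apply: (continuous_lebesgue_pt nR).
- exact: measurable_itv.
- by apply: measurable_funTS; exact: measurable_patch_Rpos.
- have ux : (u \_ Rpos) x = u x by rewrite patchE mem_set// RposE.
  rewrite /prop_for /continuous_at ux; apply: cvg_trans cu.
  apply: near_eq_cvg; have := open_nbhs_nbhs nR; apply: filterS => y Ry.
  by rewrite patchE mem_set.
Qed.

End WeakDerivative.

(** * Real and imaginary parts of Sobolev functions *)

Section SobolevFacts.
Variable R : realType.
Implicit Types (f g h u : R -> R) (v w : R -> R[i]) (x y z r s : R).
Local Notation mu := (@lebesgue_measure R).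
Local Notation Rpos := (@Rpos R).
Hint Resolve measurable_Rpos : core.

Definition re v x := complex.Re (v x).

Definition im v x := complex.Im (v x).

Definition sqmod v x := re v x ^+ 2 + im v x ^+ 2.

Lemma sqmod_ge0 v x : 0 <= sqmod v x.
Proof. by rewrite addr_ge0 ?sqr_ge0. Qed.

Lemma normc_sqmod v x : Normc.normc (v x) = Num.sqrt (sqmod v x).
Proof. by rewrite /sqmod /re /im; case: (v x). Qed.

Lemma sqr_normc_sqmod v x : Normc.normc (v x) ^+ 2 = sqmod v x.
Proof. by rewrite normc_sqmod sqr_sqrtr ?sqmod_ge0. Qed.

(** Even exponents turn powers of the modulus into polynomials in the real and
    imaginary parts. *)
Lemma LnormC_even (k : nat) v : (0 < k)%N ->
  LnormC (2 * k)%:R v =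
  ((\int[mu]_(x in Rpos) (sqmod v x ^+ k)%:E) `^ (2 * k)%:R^-1)%E.
Proof.
move=> k0; have k20 : (2 * k)%:R != 0 :> R by rewrite pnatr_eq0 muln_eq0/= -lt0n.
rewrite /LnormC unlock /Lnorm; congr (_ `^ _)%E.
rewrite [RHS]integral_mkcond; apply: eq_integral => x _; rewrite !patchE.
case: ifPn => _; last by rewrite abse0 poweR_EFin powR0.
rewrite abse_EFin poweR_EFin ger0_norm ?normc_sqmod ?sqrtr_ge0// powR_mulrn ?sqrtr_ge0//.
by rewrite exprM sqr_sqrtr ?sqmod_ge0.
Qed.

Lemma normLp_even (k : nat) v : (0 < k)%N -> integrable_pos (fun x => sqmod v x ^+ k) ->
  normLp (2 * k)%:R v ^+ (2 * k) = int_pos (fun x => sqmod v x ^+ k).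
Proof.
move=> k0 Lk; have k20 : (2 * k)%:R != 0 :> R by rewrite pnatr_eq0 muln_eq0/= -lt0n.
rewrite /normLp LnormC_even// fine_poweR -powR_mulrn ?powR_ge0// -powRrM mulVf//.
rewrite powRr1//; apply: int_pos_ge0 => x _; by rewrite exprn_ge0// sqmod_ge0.
Qed.

Lemma measurable_sqmod v : measurable_fun Rpos (re v) -> measurable_fun Rpos (im v) ->
  measurable_fun Rpos (sqmod v).
Proof. by move=> mr mi; apply: measurable_funD; exact: measurable_funX. Qed.

Lemma inL2P v : inL2 v <-> sqr_integrable (re v) /\ sqr_integrable (im v).
Proof.
rewrite /inL2 /measurable_C -/(re v) -/(im v) (@LnormC_even 1 v isT).
have -> : (\int[mu]_(x in Rpos) (sqmod v x ^+ 1)%:E =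
  \int[mu]_(x in Rpos) `|(sqmod v x)%:E|)%E.
  by apply: eq_integral => x _; rewrite expr1 abse_EFin ger0_norm ?sqmod_ge0.
split.
- move=> [[mr mi] /lty_poweRy fin].
  have Ls : integrable_pos (sqmod v).
    rewrite /integrable_pos; apply/integrableP; split.
      by apply/measurable_EFinP; exact: measurable_sqmod.
    by apply: fin; rewrite invr_eq0 pnatr_eq0.
  split; split => //; apply: (integrable_pos_le _ Ls); try exact: measurable_funX.
  + by move=> x _; rewrite normrX real_normK ?num_real// lerDl sqr_ge0.
  + by move=> x _; rewrite normrX real_normK ?num_real// lerDr sqr_ge0.
- move=> [[mr Lr] [mi Li]]; split => //.
  have := integrable_posD Lr Li; rewrite /integrable_pos => /integrableP[_ fin].
  exact: poweR_lty.
Qed.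

Lemma integrable_pos_sqmod v : inL2 v -> integrable_pos (sqmod v).
Proof. by move=> /inL2P[[_ Lr] [_ Li]]; exact: integrable_posD. Qed.

Lemma normL2 v : inL2 v -> normLp 2 v ^+ 2 = int_pos (sqmod v).
Proof.
by move=> Lv; exact: (@normLp_even 1 v isT (integrable_pos_sqmod Lv)).
Qed.

Lemma weak_derivativeP v w : weak_derivative v w <->
  (forall f, test_function f ->
    int_pos (fun x => re v x * derive1 f x) = - int_pos (fun x => re w x * f x)) /\
  (forall f, test_function f ->
    int_pos (fun x => im v x * derive1 f x) = - int_pos (fun x => im w x * f x)).
Proof.
have reM v' (k : R -> R) :
    Rintegral mu Rpos (fun x => complex.Re (v' x * (k x)%:C%C)) =
    int_pos (fun x => re v' x * k x).
  apply: eq_int_pos => x _; rewrite /re; case: (v' x) => a b /=; ring.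
have imM v' (k : R -> R) :
    Rintegral mu Rpos (fun x => complex.Im (v' x * (k x)%:C%C)) =
    int_pos (fun x => im v' x * k x).
  apply: eq_int_pos => x _; rewrite /im; case: (v' x) => a b /=; ring.
rewrite /weak_derivative /integralC; split.
- move=> weak; split => f /weak; rewrite !reM !imM => -[] //.
- by move=> [wr wi] f tf; rewrite !reM !imM wr// wi.
Qed.

Lemma plateau_weak u g :
  (forall f, test_function f ->
    int_pos (fun x => u x * derive1 f x) = - int_pos (fun x => g x * f x)) ->
  weak_on_plateaus u g.
Proof.
move=> weak x y r x0 xy r0.
by have := weak _ (plateau_test x0 (ltW xy) r0); rewrite derive1_plateau.
Qed.

Lemma within_Rnneg_continuous u x : {within @Rnneg R, continuous u} -> 0 < x ->
  {for x, continuous u}.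
Proof.
move=> cu x0; apply: (@within_continuous_continuous _ _ _ 0 (x + 1)).
- lra.
- by apply: continuous_subspaceW cu => y; rewrite /Rnneg /= !in_itv/= => /andP[-> _].
- by rewrite in_itv/= x0 ltrDl ltr01.
Qed.

Lemma int_indic x y : 0 < x -> x < y ->
  integrable_pos (\1_[set` `]x, y]]) /\ int_pos (\1_[set` `]x, y]]) = y - x.
Proof.
move=> x0 xy; split.
- apply: (@integrable_pos_bounded_support _ _ y 1).
  + by apply: measurable_indic; exact: measurable_itv.
  + by move=> s; rewrite indicE; case: (_ \in _); rewrite ?normr1 ?normr0.
  + by move=> s ys; rewrite indicE mem_setE in_itv/= [s <= _]leNgt ys andbF.
- rewrite (@int_pos_support _ _ `]x, y]).
  + rewrite (@eq_Rintegral _ _ _ _ _ (cst 1)); last first.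
      by move=> s sxy; rewrite sxy.
    rewrite Rintegral_cst; last exact: measurable_itv_lebesgue.
    rewrite mul1r -[RHS]/(fine (y - x)%:E); congr fine.
    by rewrite [LHS](lebesgue_measure_itv `]x, y])/= lte_fin xy -EFinD.
  + by move=> s /=; rewrite RposE in_itv/= => /andP[/(lt_trans x0)].
  + by move=> s _ ns; rewrite indicE mem_setE (negbTE ns).
Qed.

Lemma weak_primitive_increment u g x y : sqr_integrable u -> sqr_integrable g -> weak_on_plateaus u g ->
  (forall z, 0 < z -> {for z, continuous u}) -> 0 < x -> x < y ->
  u y - u x = int_pos (fun s => g s * \1_[set` `]x, y]] s).
Proof.
move=> Lu Lg weak cu x0 xy.
rewrite (weak_derivative_increment Lu Lg weak x0 xy); last 2 first.
- exact: continuous_Lebesgue_pt Lu.1 x0 (cu _ x0).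
- have y0 := lt_trans x0 xy; exact: continuous_Lebesgue_pt Lu.1 y0 (cu _ y0).
rewrite (@int_pos_support _ _ `]x, y]).
- by apply: eq_Rintegral => s sxy; rewrite indicE sxy mulr1.
- by move=> s /=; rewrite RposE in_itv/= => /andP[/(lt_trans x0)].
- by move=> s _ ns; rewrite indicE mem_setE (negbTE ns) mulr0.
Qed.

(** The embedding of H^1 into the bounded functions.  For [y] at distance at most
    1, |u x| <= |u y| + 1 + int g^2, and averaging over such [y] with
    |u y| <= 1 + u(y)^2 gives the bound. *)
Lemma weak_derivative_bounded u g : sqr_integrable u -> sqr_integrable g -> weak_on_plateaus u g ->
  (forall z, 0 < z -> {for z, continuous u}) ->
  forall x, 0 < x -> `|u x| <= 2 + int_pos (fun s => u s ^+ 2) + int_pos (fun s => g s ^+ 2).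
Proof.
move=> Lu Lg weak cu x x0.
set Ju := int_pos _; set Jg := int_pos (fun s => g s ^+ 2).
pose i y := \1_[set` `]x, y]] : R -> R.
have i01 y s : 0 <= i y s <= 1.
  by rewrite /i indicE; case: (_ \in _); rewrite /= ?lexx ?ler01.
have close y : x < y -> y <= x + 1 -> `|u x| <= `|u y| + (1 + Jg).
  move=> xy y1.
  have [L1 J1] := int_indic x0 xy.
  have inc : `|u y - u x| <= 1 + Jg.
    rewrite (weak_primitive_increment Lu Lg weak cu x0 xy).
    have Li : sqr_integrable (i y).
      split; first exact: integrable_pos_measurable L1.
      apply: eq_integrable_pos L1 => s _; rewrite /i !indicE.
      by case: (_ \in _); rewrite ?expr1n ?expr0n.
    have Lgi := integrable_posM Lg Li.
    have := @le_normr_Rintegral _ _ _ mu _ _ measurable_Rpos Lgi.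
    move=> /le_trans; apply.
    have Lsum : integrable_pos (fun s => i y s + g s ^+ 2) by apply: integrable_posD => //; exact: Lg.2.
    apply: (@le_trans _ _ (int_pos (fun s => i y s + g s ^+ 2))).
      apply: le_int_pos => //; first exact: integrable_pos_norm.
      move=> s _ /=; rewrite normrM; have /andP[i0 i1] := i01 y s.
      rewrite (ger0_norm i0) -[g s ^+ 2]real_normK ?num_real//.
      rewrite /i indicE; case: (_ \in _).
        by rewrite /= mulr1; move: (`|g s|) => a; have := sqr_ge0 (a - 1); have := sqr_ge0 a; nra.
      by rewrite mulr0 add0r sqr_ge0.
    by rewrite int_posD//; [rewrite J1 -/Jg; move: y1; move: Jg => J; lra|exact: Lg.2].
  have -> : u x = u y - (u y - u x) by ring.
  by apply: (le_trans (ler_normB _ _)); rewrite lerD2l.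
pose K := `|u x| - 2 - Jg.
have x1 : x < x + 1 by lra.
have [L1 J1] := int_indic x0 x1.
have : int_pos (fun s => K * i (x + 1) s) <= Ju.
  apply: le_int_pos; [exact: integrable_posZ|exact: Lu.2|].
  move=> s s0; rewrite /i indicE; case: (boolP (s \in _)) => sx; last by rewrite mulr0 sqr_ge0.
  move: sx; rewrite mem_setE in_itv/= mulr1 => /andP[xs sx1].
  have := close _ xs sx1.
  rewrite /K -[u s ^+ 2]real_normK ?num_real//.
  by move: (`|u s|) => a; have := sqr_ge0 (a - 1); have := sqr_ge0 a; nra.
by rewrite int_posZ// J1 /K; lra.
Qed.

End SobolevFacts.

(** * Perturbing a Sobolev function by a test function *)

Section Perturbation.
Variable R : realType.
Implicit Types (f g h u : R -> R) (x y z r s t : R).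
Local Notation mu := (@lebesgue_measure R).
Local Notation Rpos := (@Rpos R).
Hint Resolve measurable_Rpos : core.

Lemma continuous_bounded_support f b : 0 < b -> continuous f ->
  (forall x, x <= - b -> f x = 0) -> (forall x, b <= x -> f x = 0) ->
  sqr_integrable f.
Proof.
move=> b0 cf f0 fb.
have [c _ hc] : exists2 c, c \in `[- b, b] &
    forall t, t \in `[- b, b] -> `|f t| <= `|f c|.
  apply: (@EVT_max _ (fun x => `|f x|)); first lra.
  by apply: continuous_subspaceT => x; apply: cvg_norm; exact: cf.
apply: (@sqr_integrable_bounded_support _ _ b `|f c|).
- exact: continuous_measurable_Rpos.
- move=> x; have [xb|bx] := leP x b; last by rewrite fb ?normr0// ltW.
  have [bx|xb'] := leP (- b) x; last by rewrite f0 ?normr0// ltW.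
  by apply: hc; rewrite in_itv/= bx xb.
- by move=> x /ltW; exact: fb.
Qed.

Lemma test_function_vanish f : test_function f -> exists2 b, 0 < b &
  (forall x, (x <= 0) || (b <= x) -> f x = 0 /\ derive1 f x = 0).
Proof.
move=> [df cf K Kpos].
set S := closure _ in K Kpos.
have out x : ~ S x -> f x = 0 /\ derive1 f x = 0.
  move=> nSx; have oS : open (~` S) by apply: closed_openC; exact: closed_closure.
  have : \forall y \near x, f y = 0.
    have : nbhs x (~` S) by apply: open_nbhs_nbhs.
    apply: filterS => y nSy; apply: contrapT => fy.
    by apply: nSy; apply: subset_closure; apply/eqP.
  move=> fx; split; first exact: nbhs_singleton fx.
  apply: (@is_derive_derive1 _ f x 0).
  have e : \forall y \near x, cst 0 y = f y by apply: filterS fx => y ->.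
  exact: (near_eq_is_derive e (is_derive_cst 0 x 1)).
have [M [Mr KM]] := compact_bounded K.
exists (`|M| + 2); first by rewrite ltr_wpDl.
move=> x h; apply: out => Sx; case/orP: h => [x0|Mx].
  by have := Kpos _ Sx; rewrite RposE ltNge x0.
have M1 : M < `|M| + 1 by rewrite (le_lt_trans (ler_norm M))// ltrDl.
have := KM _ M1 x Sx; have := ler_norm x; rewrite /=; lra.
Qed.

Lemma test_function_continuous f : test_function f -> continuous f.
Proof.
move=> [df _ _ _] x; apply: differentiable_continuous; exact/derivable1_diffP.
Qed.

Lemma test_function_sqr_integrable f : test_function f -> sqr_integrable f /\ sqr_integrable (derive1 f).
Proof.
move=> tf; have [b b0 fb] := test_function_vanish tf.
have xb x : x <= - b -> x <= 0 by move=> h; lra.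
split; apply: (continuous_bounded_support b0).
- exact: test_function_continuous.
- by move=> x /xb x0; apply: (fb x _).1; rewrite x0.
- by move=> x bx; apply: (fb x _).1; rewrite bx orbT.
- by case: tf.
- by move=> x /xb x0; apply: (fb x _).2; rewrite x0.
- by move=> x bx; apply: (fb x _).2; rewrite bx orbT.
Qed.

(** Both functions vanish at 0 and beyond some [b], so that integration by parts on
    [0, b] has no boundary terms. *)
Lemma test_function_weak f h : test_function f -> test_function h ->
  int_pos (fun x => f x * derive1 h x) = - int_pos (fun x => derive1 f x * h x).
Proof.
move=> tf th; have [b b0 fb] := test_function_vanish tf.
have [Lf Lf'] := test_function_sqr_integrable tf; have [Lh Lh'] := test_function_sqr_integrable th.
have sub : `]0, b] `<=` Rpos.
  by move=> x /=; rewrite RposE in_itv/= => /andP[].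
have int0 (k : R -> R) : integrable_pos k -> (forall x, b <= x -> k x = 0) ->
    int_pos k = Rintegral mu `[0, b] k.
  move=> Lk k0; rewrite (int_pos_support sub).
    rewrite Rintegral_itv_obnd_cbnd//.
    exact: (integrableS measurable_Rpos (measurable_itv_lebesgue _) sub Lk).
  move=> x x0; rewrite in_itv/= x0/= -ltNge => /ltW; exact: k0.
have ff x : b <= x -> f x = 0 /\ derive1 f x = 0 by move=> bx; apply: fb; rewrite bx orbT.
rewrite int0; [|exact: integrable_posM|by move=> x /ff[-> _]; rewrite mul0r].
rewrite int0; [|exact: integrable_posM|by move=> x /ff[_ ->]; rewrite mul0r].
have reg k : test_function k -> {within `[0, b], continuous (derive1 k)} /\
    derivable_oo_LRcontinuous k 0 b.
  move=> tk; have ck := test_function_continuous tk; have [dk c'k _ _] := tk; split.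
    exact: continuous_subspaceT.
  split; first by move=> x _; exact: dk.
  + by apply: cvg_at_right_filter; exact: ck.
  + by apply: cvg_at_left_filter; exact: ck.
have [cf' rf] := reg _ tf; have [ch' rh] := reg _ th.
rewrite (Rintegration_by_parts b0 cf' rf _ ch' rh) //.
have [-> _] := ff b (lexx _); have [-> _] : f 0 = 0 /\ derive1 f 0 = 0.
  by apply: fb; rewrite lexx.
by rewrite !mul0r subr0 sub0r.
Qed.

(** One family provides both the variations [k = 1] and the dilations
    [s = t = 0]. *)
Definition perturb (v : R -> R[i]) f (k s t : R) : R -> R[i] :=
  fun x => Complex (k * (re v x + s * f x)) (k * (im v x + t * f x)).

Lemma sqr_integrable_perturb u f k s : sqr_integrable u -> sqr_integrable f ->
  sqr_integrable (fun x => k * (u x + s * f x)).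
Proof. by move=> Lu Lf; apply/sqr_integrableZ/sqr_integrableD => //; exact: sqr_integrableZ. Qed.

Lemma inL2_perturb v f k s t : inL2 v -> sqr_integrable f -> inL2 (perturb v f k s t).
Proof.
by move=> /inL2P[Lr Li] Lf; apply/inL2P; split; exact: sqr_integrable_perturb.
Qed.

Lemma weak_perturb u g f k s : sqr_integrable u -> sqr_integrable g -> test_function f ->
  (forall h, test_function h ->
    int_pos (fun x => u x * derive1 h x) = - int_pos (fun x => g x * h x)) ->
  forall h, test_function h ->
  int_pos (fun x => k * (u x + s * f x) * derive1 h x) =
  - int_pos (fun x => k * (g x + s * derive1 f x) * h x).
Proof.
move=> Lu Lg tf weak h th.
have [Lf Lf'] := test_function_sqr_integrable tf; have [Lh Lh'] := test_function_sqr_integrable th.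
have lin (a c d : R -> R) : sqr_integrable a -> sqr_integrable c -> sqr_integrable d ->
    int_pos (fun x => k * (a x + s * c x) * d x) =
    k * (int_pos (fun x => a x * d x) + s * int_pos (fun x => c x * d x)).
  move=> La Lc Ld; have Lad := integrable_posM La Ld; have Lcd := integrable_posM Lc Ld.
  rewrite -int_posZ// -int_posD//; last exact: integrable_posZ.
  rewrite -int_posZ; last by apply: integrable_posD => //; exact: integrable_posZ.
  by apply: eq_int_pos => x _; ring.
by rewrite !lin// weak// test_function_weak//; ring.
Qed.

Lemma H1_perturb (v : H1 R) f k s t : test_function f ->
  exists w : H1 R, H1_fun w = perturb v f k s t /\
    H1_der w = perturb (H1_der v) (derive1 f) k s t.
Proof.
move=> tf; have [Lf Lf'] := test_function_sqr_integrable tf.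
have [Lr Li] := (inL2P _).1 (H1_L2 v).
have [Lr' Li'] := (inL2P _).1 (H1_der_L2 v).
have [wr wi] := (weak_derivativeP _ _).1 (H1_weak_derivative v).
have [cr ci] := H1_continuous v.
have L2 := inL2_perturb k s t (H1_L2 v) Lf.
have L2' := inL2_perturb k s t (H1_der_L2 v) Lf'.
have W : weak_derivative (perturb v f k s t) (perturb (H1_der v) (derive1 f) k s t).
  by apply/weak_derivativeP; split => h th; exact: weak_perturb th.
have C (u : R -> R) (c : R) : {within @Rnneg R, continuous u} ->
    {within @Rnneg R, continuous (fun x => k * (u x + c * f x))}.
  have cf : {within @Rnneg R, continuous f}.
    by apply: continuous_subspaceT; exact: test_function_continuous.
  move=> cu x; apply: cvgMr; apply: cvgD; first exact: cu.
  by apply: cvgMr; exact: cf.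
by exists (MkH1 L2 L2' W (conj (C _ s cr) (C _ t ci))).
Qed.

End Perturbation.

(** * The quadratic and the sextic energy *)

Section Energies.
Variable R : realType.
Implicit Types (f g h u : R -> R) (x y z r s t : R) (v w : H1 R).
Local Notation mu := (@lebesgue_measure R).
Local Notation Rpos := (@Rpos R).
Hint Resolve measurable_Rpos : core.

Lemma H1_re v : sqr_integrable (re v) /\ sqr_integrable (re (H1_der v)).
Proof. by have [] := (inL2P _).1 (H1_L2 v); have [] := (inL2P _).1 (H1_der_L2 v). Qed.

Lemma H1_im v : sqr_integrable (im v) /\ sqr_integrable (im (H1_der v)).
Proof. by have [] := (inL2P _).1 (H1_L2 v); have [] := (inL2P _).1 (H1_der_L2 v). Qed.

Lemma H1_plateau_re v : weak_on_plateaus (re v) (re (H1_der v)).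
Proof. exact: (plateau_weak ((weak_derivativeP _ _).1 (H1_weak_derivative v)).1). Qed.

Lemma H1_plateau_im v : weak_on_plateaus (im v) (im (H1_der v)).
Proof. exact: (plateau_weak ((weak_derivativeP _ _).1 (H1_weak_derivative v)).2). Qed.

Lemma H1_continuous_pos v x : 0 < x ->
  {for x, continuous (re v)} /\ {for x, continuous (im v)}.
Proof.
move=> x0; have [cr ci] := H1_continuous v.
by split; exact: within_Rnneg_continuous x0.
Qed.

Lemma sqmod_bounded v : exists M, forall x, 0 < x -> sqmod v x <= M.
Proof.
have [Lr Lr'] := H1_re v; have [Li Li'] := H1_im v.
have cr z : 0 < z -> {for z, continuous (re v)} by move=> /(H1_continuous_pos v)[].
have ci z : 0 < z -> {for z, continuous (im v)} by move=> /(H1_continuous_pos v)[].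
have [A br] : exists A, forall x, 0 < x -> `|re v x| <= A.
  by eexists; exact: (weak_derivative_bounded Lr Lr' (@H1_plateau_re v) cr).
have [B bi] : exists B, forall x, 0 < x -> `|im v x| <= B.
  by eexists; exact: (weak_derivative_bounded Li Li' (@H1_plateau_im v) ci).
exists (A ^+ 2 + B ^+ 2) => x x0; rewrite /sqmod.
rewrite -[re v x ^+ 2]real_normK ?num_real// -[im v x ^+ 2]real_normK ?num_real//.
have := br x x0; have := bi x x0; have := normr_ge0 (re v x).
have := normr_ge0 (im v x); move: (`|re v x|) (`|im v x|) => a b; nra.
Qed.

Lemma measurable_sqmod_H1 v : measurable_fun Rpos (sqmod v).
Proof. by apply: measurable_sqmod; [case: (H1_re v) => -[]|case: (H1_im v) => -[]]. Qed.

Lemma integrable_pos_sqmod_H1 v : integrable_pos (sqmod v).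
Proof. exact: integrable_pos_sqmod (H1_L2 v). Qed.

Lemma integrable_pos_sqmod3 v : integrable_pos (fun x => sqmod v x ^+ 3).
Proof.
have [M sM] := sqmod_bounded v.
apply: (@eq_integrable_pos _ (fun x => sqmod v x ^+ 2 * sqmod v x)).
  by move=> x _; rewrite -exprSr.
apply: (@integrable_posM_bounded _ _ _ (M ^+ 2)).
- by apply: measurable_funX; exact: measurable_sqmod_H1.
- move=> x /sM sxM; rewrite normrX lerXn2r ?nnegrE ?ger0_norm ?sqmod_ge0//.
  by rewrite (le_trans _ sxM) ?sqmod_ge0.
- exact: integrable_pos_sqmod_H1.
Qed.

Definition quadratic alpha omega v :=
  int_pos (sqmod (H1_der v)) + omega * int_pos (sqmod v) + alpha * sqmod v 0.

Definition sextic v := int_pos (fun x => sqmod v x ^+ 3).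

(** Boundedness is essential: if the integral diverged, [fine] would turn the norm
    into 0. *)
Lemma normL6 v : normLp 6 v ^+ 6 = sextic v.
Proof. exact: (@normLp_even _ 3 v isT (integrable_pos_sqmod3 v)). Qed.

Lemma K_funE alpha omega v :
  K_fun alpha omega v = quadratic alpha omega v - 3 / 16 * sextic v.
Proof.
by rewrite /K_fun normL6 (normL2 (H1_der_L2 v)) (normL2 (H1_L2 v)) sqr_normc_sqmod.
Qed.

Lemma S_funE alpha omega v :
  S_fun alpha omega v = 2^-1 * quadratic alpha omega v - 32^-1 * sextic v.
Proof.
by rewrite /S_fun normL6 (normL2 (H1_der_L2 v)) (normL2 (H1_L2 v)) sqr_normc_sqmod.
Qed.

Lemma sextic_ge0 v : 0 <= sextic v.
Proof. by apply: int_pos_ge0 => x _; rewrite exprn_ge0 ?sqmod_ge0. Qed.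

Lemma sextic_gt0 v : H1_nonzero v <-> 0 < sextic v.
Proof.
have m3 : measurable_fun Rpos (fun x => sqmod v x ^+ 3).
  exact: integrable_pos_measurable (integrable_pos_sqmod3 v).
split.
- move=> nz; rewrite lt_neqAle sextic_ge0 andbT eq_sym; apply/eqP => s0; apply: nz.
  have : (\int[mu]_(x in Rpos) `|(sqmod v x ^+ 3)%:E| = 0)%E.
    have -> : (\int[mu]_(x in Rpos) `|(sqmod v x ^+ 3)%:E| =
        \int[mu]_(x in Rpos) (sqmod v x ^+ 3)%:E)%E.
      apply: eq_integral => x _.
      by rewrite abse_EFin ger0_norm// exprn_ge0 ?sqmod_ge0.
    rewrite -[LHS]fineK; last exact: (integrable_fin_num measurable_Rpos (integrable_pos_sqmod3 v)).
    by rewrite -[fine _]/(sextic v) s0.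
  move/ae_eq_integral_abs => [//||N [mN N0 sub]].
    by apply/measurable_EFinP.
  exists N; split => // x /= nx; apply: sub => /= sx; apply: nx => Rx.
  have [/eqP] := sx Rx; rewrite expf_eq0/= paddr_eq0 ?sqr_ge0// !sqrf_eq0.
  by rewrite /re /im; case: (H1_fun v x) => a b /= /andP[/eqP -> /eqP ->].
- move=> s0 [N [mN N0 sub]].
  suff : sextic v = 0 by move=> e; rewrite e ltxx in s0.
  rewrite /sextic (@int_pos_ae _ _ (cst 0)) //.
    by rewrite /int_pos /Rintegral integral0.
  exists N; split => // x /= nx; apply: sub => /= vx; apply: nx => Rx.
  by rewrite /sqmod /re /im vx// !expr0n/= addr0 expr0n.
Qed.

End Energies.

(** * The Euler-Lagrange equation *)

Section EulerLagrange.
Variable R : realType.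
Implicit Types (f g h u : R -> R) (x y z r s t : R) (v w : H1 R).
Local Notation mu := (@lebesgue_measure R).
Local Notation Rpos := (@Rpos R).
Hint Resolve measurable_Rpos : core.

(** On the constraint the quadratic part is 3/16 of the sextic one, so that the
    action is 3/32 - 1/32 = 1/16 of it: minimizing the action is minimizing the
    sextic energy. *)
Lemma minimizer_sextic alpha omega v : minimizer alpha omega v ->
  [/\ quadratic alpha omega v = 3 / 16 * sextic v, 0 < sextic v &
   forall w, quadratic alpha omega w = 3 / 16 * sextic w -> 0 < sextic w ->
     sextic v <= sextic w].
Proof.
move=> [[/eqP]]; rewrite K_funE subr_eq0 => /eqP qv /sextic_gt0 sv dv.
split => // w qw sw.
have : ((S_fun alpha omega v)%:E <= (S_fun alpha omega w)%:E)%E.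
  rewrite dv; apply: ereal_inf_lbound; exists w => //; split.
  - by rewrite K_funE qw subrr.
  - exact/sextic_gt0.
rewrite lee_fin !S_funE qv qw; lra.
Qed.

Lemma H1_scale alpha omega v k : exists w,
  quadratic alpha omega w = k ^+ 2 * quadratic alpha omega v /\
  sextic w = k ^+ 6 * sextic v.
Proof.
(* Any test function serves: its coefficients are 0. *)
have tf : test_function (plateau 1 1 1 : R -> R) by apply: plateau_test; rewrite ?lexx.
have [w [ew edw]] := H1_perturb v k 0 0 tf.
have sw x : sqmod w x = k ^+ 2 * sqmod v x.
  by rewrite /sqmod /re /im ew /perturb /re /im /=; ring.
have sdw x : sqmod (H1_der w) x = k ^+ 2 * sqmod (H1_der v) x.
  by rewrite /sqmod /re /im edw /perturb /re /im /=; ring.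
exists w; rewrite /quadratic /sextic; split.
- rewrite (eq_int_pos (fun x _ => sw x)) (eq_int_pos (fun x _ => sdw x)) sw.
  rewrite !int_posZ; [ring|exact: integrable_pos_sqmod_H1|exact: integrable_pos_sqmod (H1_der_L2 v)].
- rewrite -int_posZ; last exact: integrable_pos_sqmod3.
  by apply: eq_int_pos => x _; rewrite sw; ring.
Qed.

(** The competitor is [k w] with k^4 = 16 Q(w) / (3 N6(w)), the dilation that
    brings [w] onto the constraint. *)
Lemma minimizer_homogeneous alpha omega v w : minimizer alpha omega v ->
  0 < quadratic alpha omega w -> 0 < sextic w ->
  quadratic alpha omega v ^+ 3 * sextic w <= quadratic alpha omega w ^+ 3 * sextic v.
Proof.
move=> /minimizer_sextic[qv sv vmin] qw sw.
pose m := Num.sqrt (16 * quadratic alpha omega w / (3 * sextic w)).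
have m0 : 0 <= m by exact: sqrtr_ge0.
have m2 : m ^+ 2 * (3 * sextic w) = 16 * quadratic alpha omega w.
  rewrite sqr_sqrtr ?divr_ge0 ?mulr_ge0 ?ltW// divfK//.
  by rewrite mulf_neq0// gt_eqF.
pose k := Num.sqrt m.
have k2 : k ^+ 2 = m by rewrite sqr_sqrtr.
have [w' [qw' sw']] := H1_scale alpha omega w k.
have k6 : k ^+ 6 = m ^+ 3 by rewrite -k2 -exprM.
rewrite k2 in qw'; rewrite k6 in sw'.
have mp : 0 < m by rewrite sqrtr_gt0 divr_gt0// mulr_gt0.
have sle : sextic v <= m ^+ 3 * sextic w.
  rewrite -sw'; apply: vmin.
  - rewrite qw' sw'.
    have -> : quadratic alpha omega w = m ^+ 2 * (3 * sextic w) / 16 by rewrite m2; field.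
    by field.
  - by rewrite sw' mulr_gt0// exprn_gt0.
have qE : quadratic alpha omega w = 3 / 16 * (m ^+ 2 * sextic w).
  by have : 16 * quadratic alpha omega w = m ^+ 2 * (3 * sextic w) by []; lra.
rewrite qv qE; set D0 := sextic v in sv sle *; set D := sextic w in sw sle *.
have : D0 ^+ 2 <= (m ^+ 3 * D) ^+ 2 by rewrite lerXn2r// nnegrE ltW// (lt_le_trans sv).
rewrite -subr_ge0 => sq; rewrite -subr_ge0.
have -> : (3 / 16 * (m ^+ 2 * D)) ^+ 3 * D0 - (3 / 16 * D0) ^+ 3 * D =
  27 / 4096 * (D * D0) * ((m ^+ 3 * D) ^+ 2 - D0 ^+ 2) by field.
apply: mulr_ge0 sq; apply: mulr_ge0; first by apply: divr_ge0; exact: ler0n.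
by apply: mulr_ge0; exact: ltW.
Qed.

(** The two sides of the inequality agree at [t = 0], which is therefore a local
    minimum of their difference. *)
Lemma first_order_condition (Q0 D0 a b c : R) : 0 < Q0 -> 0 < D0 ->
  (forall t, 0 < Q0 + 2 * t * b + t ^+ 2 * a -> 0 < D0 + t * c ->
    Q0 ^+ 3 * (D0 + t * c) <= (Q0 + 2 * t * b + t ^+ 2 * a) ^+ 3 * D0) ->
  6 * b * D0 = Q0 * c.
Proof.
move=> q0 d0 H.
pose F t := (Q0 + 2 * t * b + t ^+ 2 * a) ^+ 3 * D0 - Q0 ^+ 3 * (D0 + t * c).
have dF t : is_derive t 1 F ((3 * (Q0 + 2 * t * b + t ^+ 2 * a) ^+ 2 *
    (2 * b + 2 * t * a)) * D0 - Q0 ^+ 3 * c).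
  rewrite /F; derive_eq; first by derive_tac.
  by rewrite /=; ring.
(* For |t| < e both positivity conditions hold. *)
pose e := Num.min 1 (Num.min (Q0 / (2 * `|b| + `|a| + 1)) (D0 / (`|c| + 1))).
have B0 : 0 < 2 * `|b| + `|a| + 1.
  by have := normr_ge0 b; have := normr_ge0 a; lra.
have C0 : 0 < `|c| + 1 by have := normr_ge0 c; lra.
have e0 : 0 < e by rewrite !lt_min ltr01 !divr_gt0.
have F0 : F 0 = 0 by rewrite /F; ring.
have Fge t : t \in `]- e, e[ -> F 0 <= F t.
  rewrite in_itv/= -ltr_norml !lt_min => /and3P[t1 tb tc].
  rewrite F0 subr_ge0; apply: H.
  - move: tb; rewrite ltr_pdivlMr// => tb.
    have t2b : - (`|t| * (2 * `|b|)) <= 2 * t * b.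
      have : `|2 * t * b| <= `|t| * (2 * `|b|).
        by rewrite !normrM ger0_norm//; lra.
      by rewrite ler_norml => /andP[].
    have t2a : - (`|t| * `|a|) <= t ^+ 2 * a.
      have : `|t ^+ 2 * a| <= `|t| * `|a|.
        by rewrite normrM normrX ler_wpM2r// expr2 ler_piMl// ltW.
      by rewrite ler_norml => /andP[].
    have := normr_ge0 t; lra.
  - move: tc; rewrite ltr_pdivlMr// => tc.
    have : `|t * c| <= `|t| * `|c| by rewrite normrM.
    rewrite ler_norml => /andP[tc' _].
    have := normr_ge0 t; lra.
have ee : - e <= e by lra.
have e0in : 0 \in `]- e, e[ by rewrite in_itv/= e0 oppr_lt0 e0.
have d0F := derive1_at_min ee (fun t _ => @ex_derive _ _ _ _ _ _ _ (dF t)) e0in Fge.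
have := is_derive_derive1 d0F; rewrite (is_derive_derive1 (dF 0)).
move=> h; have : Q0 ^+ 2 * (6 * b * D0 - Q0 * c) = 0 by rewrite -[RHS]h; ring.
move/eqP; rewrite mulf_eq0 expf_eq0/= gt_eqF//= subr_eq0 => /eqP.
exact.
Qed.

Lemma sqr_integrable_sqmod2M v f : sqr_integrable f -> sqr_integrable (fun x => sqmod v x ^+ 2 * f x).
Proof.
move=> Lf; have [M sM] := sqmod_bounded v.
apply: (@sqr_integrableM_bounded _ _ _ (M ^+ 2)) => //.
- by apply: measurable_funX; exact: measurable_sqmod_H1.
- move=> x /sM sxM; rewrite normrX lerXn2r ?nnegrE ?ger0_norm ?sqmod_ge0//.
  by rewrite (le_trans _ sxM) ?sqmod_ge0.
Qed.

(** The direction is [(c + i d) f].  The quadratic energy is expanded exactly.  For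
    the sextic one a lower bound that is exact to first order is enough, because
    the energies are compared by an inequality, and convexity of the cube on the
    nonnegative reals provides it. *)
Lemma minimizer_critical alpha omega v (c d : R) f : minimizer alpha omega v ->
  test_function f ->
  int_pos (fun x => (c * re (H1_der v) x + d * im (H1_der v) x) * derive1 f x) +
  omega * int_pos (fun x => (c * re v x + d * im v x) * f x) =
  3 / 16 * int_pos (fun x => sqmod v x ^+ 2 * (c * re v x + d * im v x) * f x).
Proof.
move=> vmin tf; have [qv sv _] := minimizer_sextic vmin.
have [Lf Lf'] := test_function_sqr_integrable tf.
have [Lr Lr'] := H1_re v; have [Li Li'] := H1_im v.
have Lm : sqr_integrable (fun x => c * re v x + d * im v x).
  by apply: sqr_integrableD; exact: sqr_integrableZ.
have Lm' : sqr_integrable (fun x => c * re (H1_der v) x + d * im (H1_der v) x).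
  by apply: sqr_integrableD; exact: sqr_integrableZ.
have Lmf := integrable_posM Lm Lf; have Lmf' := integrable_posM Lm' Lf'.
have Lcub := integrable_posM (sqr_integrable_sqmod2M v Lm) Lf.
set b1 := int_pos _; set b2 := int_pos _; set c1 := int_pos _.
pose k := c ^+ 2 + d ^+ 2.
pose a := k * (int_pos (fun x => derive1 f x ^+ 2) + omega * int_pos (fun x => f x ^+ 2)).
have sqP (g : R -> R[i]) h t : inL2 g -> sqr_integrable h ->
  int_pos (sqmod (perturb g h 1 (t * c) (t * d))) =
  int_pos (sqmod g) + 2 * t * int_pos (fun x => (c * re g x + d * im g x) * h x)
   + t ^+ 2 * (k * int_pos (fun x => h x ^+ 2)).
  move=> Lg Lh; have [Lgr Lgi] := (inL2P _).1 Lg.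
  have Lgh : integrable_pos (fun x => (c * re g x + d * im g x) * h x).
    by apply: integrable_posM => //; apply: sqr_integrableD; exact: sqr_integrableZ.
  have Lh2 := Lh.2.
  rewrite mulrA -int_posZ// -int_posZ// -int_posD; [|exact: integrable_pos_sqmod|exact: integrable_posZ].
  rewrite -int_posD; [|by apply: integrable_posD; [exact: integrable_pos_sqmod|exact: integrable_posZ]|exact: integrable_posZ].
  by apply: eq_int_pos => x _; rewrite /k /sqmod /perturb /re /im /=; ring.
have : 6 * (b1 + omega * b2) * sextic v = quadratic alpha omega v * (6 * c1).
  apply: (@first_order_condition _ _ a).
  - by rewrite qv; lra.
  - exact: sv.
  move=> t; have [w [ew edw]] := H1_perturb v 1 (t * c) (t * d) tf.
  have f0 : f 0 = 0.
    by have [? _ fb] := test_function_vanish tf; apply: (fb 0 _).1; rewrite lexx.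
  have qw : quadratic alpha omega w =
      quadratic alpha omega v + 2 * t * (b1 + omega * b2) + t ^+ 2 * a.
    rewrite /quadratic ew edw !sqP//; [|exact: H1_L2|exact: H1_der_L2].
    rewrite -/b1 -/b2 /a.
    have -> : sqmod (perturb v f 1 (t * c) (t * d)) 0 = sqmod v 0.
      by rewrite /sqmod /perturb /re /im /= f0; ring.
    ring.
  have sw : sextic v + t * (6 * c1) <= sextic w.
    rewrite /sextic ew /c1 mulrA -int_posZ// -int_posD//; last 2 first.
    - exact: integrable_pos_sqmod3.
    - exact: integrable_posZ.
    apply: le_int_pos.
    + by apply: integrable_posD; [exact: integrable_pos_sqmod3|exact: integrable_posZ].
    + by rewrite -ew; exact: integrable_pos_sqmod3.
    move=> x _; set X := sqmod (perturb _ _ _ _ _) x.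
    have X0 : 0 <= X by exact: sqmod_ge0.
    have N0 := sqmod_ge0 v x.
    have XN : sqmod v x + 2 * t * ((c * re v x + d * im v x) * f x) <= X.
      rewrite -subr_ge0.
      have -> : X - (sqmod v x + 2 * t * ((c * re v x + d * im v x) * f x)) =
         (t * c * f x) ^+ 2 + (t * d * f x) ^+ 2.
        by rewrite /X /sqmod /perturb /re /im /=; ring.
      by rewrite addr_ge0 ?sqr_ge0.
    (* The tangent to the cube at [sqmod v x]. *)
    apply: (@le_trans _ _ (sqmod v x ^+ 3 + 3 * sqmod v x ^+ 2 * (X - sqmod v x))).
      rewrite lerD2l.
      have := ler_wpM2l (_ : 0 <= 3 * sqmod v x ^+ 2) XN.
      rewrite mulr_ge0 ?sqr_ge0// => /(_ isT); lra.
    rewrite -subr_ge0.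
    have -> : X ^+ 3 - (sqmod v x ^+ 3 + 3 * sqmod v x ^+ 2 * (X - sqmod v x)) =
      (X - sqmod v x) ^+ 2 * (X + 2 * sqmod v x) by ring.
    by rewrite mulr_ge0 ?sqr_ge0// addr_ge0// mulr_ge0.
  rewrite -qw => qw0 st0; have sw0 := lt_le_trans st0 sw.
  apply: le_trans (minimizer_homogeneous vmin qw0 sw0).
  by rewrite ler_wpM2l// exprn_ge0// qv; lra.
rewrite qv => e.
have : sextic v * (6 * (b1 + omega * b2) - 6 * (3 / 16 * c1)) = 0 by lra.
move/eqP; rewrite mulf_eq0 gt_eqF//= => /eqP; lra.
Qed.

End EulerLagrange.

(** * Regularity *)

Section Regularity.
Variable R : realType.
Implicit Types (f g h u : R -> R) (x y z r s t : R) (v w : H1 R).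
Local Notation mu := (@lebesgue_measure R).
Local Notation Rpos := (@Rpos R).
Hint Resolve measurable_Rpos : core.

Lemma near_Rpos x : 0 < x -> \forall y \near x, 0 < y.
Proof. by move=> x0; exact: lt_nbhsr. Qed.

Lemma is_derive_primitive g x : sqr_integrable g -> 0 < x -> {for x, continuous g} ->
  is_derive x 1 (primitive g) (g x).
Proof.
move=> Lg x0 cg.
have xx : x < x + 1 by rewrite ltrDl.
have ax : (BRight 0 < BRight x)%O by rewrite bnd_simp.
have [d e] := continuous_FTC1 xx (sqr_integrable_itv (x + 1) Lg) ax cg.
by split => //; rewrite -derive1E.
Qed.

Lemma sqr_integrable_ae f g : sqr_integrable f -> measurable_fun Rpos g ->
  {ae mu, forall x, Rpos x -> f x = g x} -> sqr_integrable g.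
Proof.
move=> [mf f2] mg fg; split => //; rewrite /integrable_pos; apply/integrableP; split.
  by apply/measurable_EFinP; exact: measurable_funX.
have := f2; rewrite /integrable_pos => /integrableP[_]; congr (_ < _)%E.
apply: ae_eq_integral => //.
- by apply/measurable_EFinP; apply: measurableT_comp => //; exact: measurable_funX.
- by apply/measurable_EFinP; apply: measurableT_comp => //; exact: measurable_funX.
case: fg => N [mN N0 sub]; exists N; split => // x nx; apply: sub => fgx.
by apply: nx => /fgx /= ->.
Qed.

Lemma continuous_measurable_on_Rpos g : (forall x, 0 < x -> {for x, continuous g}) ->
  measurable_fun Rpos g.
Proof.
move=> cg; apply: open_continuous_measurable_fun; first exact: interval_open.
by move=> x; rewrite inE RposE => /cg.
Qed.

(** Bootstrap: the weak derivative [U] of [u] has itself a continuous weak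
    derivative [F], so it agrees almost everywhere with a primitive [G] of [F],
    and [u] is a primitive of [G]. *)
Lemma weak_derivative_regular u U F : sqr_integrable u -> sqr_integrable U -> sqr_integrable F ->
  weak_on_plateaus u U -> weak_on_plateaus U F ->
  (forall x, 0 < x -> {for x, continuous u}) ->
  (forall x, 0 < x -> {for x, continuous F}) ->
  exists G, [/\ forall x, 0 < x -> is_derive x 1 u (G x),
    forall x, 0 < x -> is_derive x 1 G (F x), sqr_integrable G &
    {ae mu, forall x, Rpos x -> U x = G x}].
Proof.
move=> Lu LU LF uU UF cu cF.
have [c Uc] := weak_derivative_primitive LU LF UF.
pose G x := c + primitive F x.
have dG x : 0 < x -> is_derive x 1 G (F x).
  move=> x0; rewrite /G -[F x]add0r.
  exact: (is_deriveD_fun (is_derive_cst_fun _ _) (is_derive_primitive LF x0 (cF x x0))).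
have UG : {ae mu, forall x, Rpos x -> U x = G x}.
  case: (sqr_integrable_lebesgue_pt LU) => N [mN N0 sub]; exists N; split => // x nx.
  by apply: sub => lx; apply: nx => Rx; apply: Uc => //; rewrite -RposE.
have cG x : 0 < x -> {for x, continuous G} by move=> /dG; exact: is_derive_continuous.
have mG := continuous_measurable_on_Rpos cG.
have LG := sqr_integrable_ae LU mG UG.
have uG : weak_on_plateaus u G.
  move=> x y r x0 xy r0; rewrite uU//; congr (- _).
  have mp : measurable_fun Rpos (plateau x y r).
    apply: continuous_measurable_Rpos => s.
    exact: is_derive_continuous (is_derive_plateau x y r s).
  apply: int_pos_ae; [exact: measurable_funM LU.1 mp|exact: measurable_funM|].
  case: UG => N [mN N0 sub]; exists N; split => // s ns; apply: sub => UGs.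
  by apply: ns => /UGs ->.
have [d ud] := weak_derivative_primitive Lu LG uG.
exists G; split => // x x0.
have e : \forall y \near x, d + primitive G y = u y.
  apply: filterS (near_Rpos x0) => y y0; rewrite -ud//.
  exact: continuous_Lebesgue_pt Lu.1 y0 (cu _ y0).
apply: (near_eq_is_derive e); rewrite -[G x]add0r.
exact: (is_deriveD_fun (is_derive_cst_fun _ _) (is_derive_primitive LG x0 (cG x x0))).
Qed.

Lemma monotone_of_derivative f df : (forall x, 0 < x -> is_derive x 1 f (df x)) ->
  (forall x, 0 < x -> 0 <= df x) -> forall x y, 0 < x -> x <= y -> f x <= f y.
Proof.
move=> dF df0 x y x0 xy.
apply: (@ger0_derive1_ndecr _ f x y) => //.
- move=> z; rewrite in_itv/= => /andP[/(lt_trans x0) z0 _]; by have [] := dF z z0.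
- move=> z; rewrite in_itv/= => /andP[/(lt_trans x0) z0 _].
  by rewrite (is_derive_derive1 (dF z z0)) df0.
- apply: continuous_in_subspaceT => z; rewrite inE/= in_itv/= => /andP[xz _].
  exact: is_derive_continuous (dF z (lt_le_trans x0 xz)).
Qed.

Lemma constant_of_derivative f : (forall x, 0 < x -> is_derive x 1 f 0) ->
  forall x y, 0 < x -> 0 < y -> f x = f y.
Proof.
move=> df.
have le x y : 0 < x -> x <= y -> f x = f y.
  move=> x0 xy; apply/eqP; rewrite eq_le (monotone_of_derivative df)//=.
  rewrite -lerN2.
  apply: (@monotone_of_derivative (fun z => - f z) (fun=> - 0)); [| |exact: x0|exact: xy].
  - by move=> z z0; exact: (is_deriveN_fun (df z z0)).
  - by move=> z _; rewrite /= oppr0.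
by move=> x y x0 y0; case: (leP x y) => [/le->//|/ltW/le->].
Qed.

(** The half-line has infinite measure.  An interval of length
    (int |f| + 1) / |f x| to the right of [x] already contradicts a nonzero
    value. *)
Lemma integrable_pos_constant f : integrable_pos f -> (forall x y, 0 < x -> 0 < y -> f x = f y) ->
  forall x, 0 < x -> f x = 0.
Proof.
move=> Lf fc x x0; apply/eqP; rewrite -normr_eq0; apply: contrapT => /negP fx.
have f0 : 0 < `|f x| by rewrite lt_neqAle eq_sym fx normr_ge0.
pose b := x + (int_pos (fun s => `|f s|) + 1) / `|f x|.
have J0 : 0 <= int_pos (fun s => `|f s|) by apply: int_pos_ge0.
have xb : x < b by rewrite ltrDl divr_gt0// ltr_wpDl.
have [L1 J1] := int_indic x0 xb.
have : int_pos (fun s => `|f x| * \1_[set` `]x, b]] s) <= int_pos (fun s => `|f s|).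
  apply: le_int_pos; [exact: integrable_posZ|exact: integrable_pos_norm|].
  move=> s s0; rewrite (fc s x)// indicE ler_piMr//.
  by case: (_ \in _).
rewrite int_posZ// J1 /b addrC addKr mulrC divfK ?gt_eqF//; lra.
Qed.

End Regularity.

(** * Standing waves of the quintic equation *)

Section StandingWave.
Variable R : realType.
Variables (omega : R) (p q G H : R -> R).
Implicit Types x y z : R.

Let N x := p x ^+ 2 + q x ^+ 2.

Hypothesis omega_gt0 : 0 < omega.
Hypothesis dp : forall x, 0 < x -> is_derive x 1 p (G x).
Hypothesis dq : forall x, 0 < x -> is_derive x 1 q (H x).
Hypothesis dG : forall x, 0 < x ->
  is_derive x 1 G (omega * p x - 3 / 16 * (N x ^+ 2 * p x)).
Hypothesis dH : forall x, 0 < x ->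
  is_derive x 1 H (omega * q x - 3 / 16 * (N x ^+ 2 * q x)).
Hypotheses (Lp : sqr_integrable p) (Lq : sqr_integrable q) (LG : sqr_integrable G) (LH : sqr_integrable H).
Hypothesis LN3 : integrable_pos (fun x => N x ^+ 3).

(** The left side minus the right side has zero derivative by the equations of [G]
    and [H], and it is integrable. *)
Lemma wave_energy x : 0 < x ->
  G x ^+ 2 + H x ^+ 2 = omega * N x - N x ^+ 3 / 16.
Proof.
pose E y := G y ^+ 2 + H y ^+ 2 - omega * N y + 16^-1 * N y ^+ 3.
have LE : integrable_pos E.
  apply: integrable_posD; last exact: integrable_posZ.
  apply: integrable_posB; first by apply: integrable_posD; [exact: LG.2|exact: LH.2].
  by apply: integrable_posZ; apply: integrable_posD; [exact: Lp.2|exact: Lq.2].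
have dE y : 0 < y -> is_derive y 1 E 0.
  move=> y0; have dpy := dp y0; have dqy := dq y0; have dGy := dG y0; have dHy := dH y0.
  rewrite /E /N; derive_eq; first by derive_tac.
  by rewrite /N /=; field.
move=> x0; have := integrable_pos_constant LE (constant_of_derivative dE) x0.
rewrite /E; lra.
Qed.

(** The nonlinearity is real and radial, so that [p * H - q * G] has zero
    derivative; it is integrable as well. *)
Lemma wave_momentum x : 0 < x -> p x * H x = q x * G x.
Proof.
pose M y := p y * H y - q y * G y.
have LM : integrable_pos M by apply: integrable_posB; exact: integrable_posM.
have dM y : 0 < y -> is_derive y 1 M 0.
  move=> y0; have dpy := dp y0; have dqy := dq y0; have dGy := dG y0; have dHy := dH y0.
  rewrite /M; derive_eq; first by derive_tac.
  by rewrite /=; ring.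
move=> x0; have := integrable_pos_constant LM (constant_of_derivative dM) x0.
rewrite /M; lra.
Qed.

Let N_ge0 x : 0 <= N x. Proof. by rewrite addr_ge0 ?sqr_ge0. Qed.

Let h x := p x * G x + q x * H x.

Let dN x : 0 < x -> is_derive x 1 N (2 * h x).
Proof.
move=> x0; have dpy := dp x0; have dqy := dq x0.
rewrite /N; derive_eq; first by derive_tac.
by rewrite /h /=; ring.
Qed.

(** Lagrange's identity, in which the momentum term vanishes. *)
Let h_sqr x : 0 < x -> h x ^+ 2 = N x * (omega * N x - N x ^+ 3 / 16).
Proof.
move=> x0; rewrite -wave_energy//.
have -> : h x ^+ 2 = N x * (G x ^+ 2 + H x ^+ 2) - (p x * H x - q x * G x) ^+ 2.
  by rewrite /h /N; ring.
by rewrite wave_momentum// subrr expr0n subr0.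
Qed.

(** The exponential rate of 1/N, whose equation is (1/N)'' = rate^2 (1/N). *)
Definition rate := 2 * Num.sqrt omega.

Lemma rate_gt0 : 0 < rate. Proof. by rewrite mulr_gt0// sqrtr_gt0. Qed.

Lemma rate_sqr : rate ^+ 2 = 4 * omega.
Proof. by rewrite exprMn sqr_sqrtr ?ltW//; ring. Qed.

Let h_le x : 0 < x -> `|2 * h x| <= rate * N x.
Proof.
move=> x0; rewrite -(@ler_pXn2r _ 2)// ?nnegrE ?mulr_ge0 ?(ltW rate_gt0)//.
rewrite real_normK ?num_real// [(2 * h x) ^+ 2]exprMn h_sqr//.
rewrite [(rate * _) ^+ 2]exprMn rate_sqr.
rewrite -subr_ge0; have -> : 4 * omega * N x ^+ 2 -
  2 ^+ 2 * (N x * (omega * N x - N x ^+ 3 / 16)) = (N x ^+ 2) ^+ 2 / 4 by field.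
by rewrite divr_ge0// sqr_ge0.
Qed.

(** By [h_le], [N * expR (rate * x)] is nondecreasing and [N * expR (- rate * x)]
    is nonincreasing; the first carries positivity to the right and the second
    to the left. *)
Lemma wave_nonvanishing x0 : 0 < x0 -> N x0 != 0 -> forall x, 0 < x -> 0 < N x.
Proof.
move=> x00 Nx0 x xpos.
have Npos : 0 < N x0 by rewrite lt_neqAle eq_sym Nx0 N_ge0.
have dexp (k y : R) : 0 < y -> is_derive y 1 (fun z => N z * expR (k * z))
    ((2 * h y + k * N y) * expR (k * y)).
  move=> y0; have dNy := dN y0; derive_eq; first by derive_tac.
  by rewrite /=; ring.
have [xx0|x0x] := leP x0 x.
- have : N x0 * expR (rate * x0) <= N x * expR (rate * x).
    apply: (monotone_of_derivative (dexp rate)) => // y y0.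
    rewrite mulr_ge0 ?expR_ge0//.
    by have := h_le y0; rewrite ler_norml => /andP[]; lra.
  move=> le; rewrite -(pmulr_lgt0 _ (expR_gt0 (rate * x))).
  by apply: lt_le_trans le; rewrite mulr_gt0// expR_gt0.
- have : - (N x * expR (- rate * x)) <= - (N x0 * expR (- rate * x0)).
    apply: (@monotone_of_derivative _ (fun z => - (N z * expR (- rate * z)))
      (fun y => - ((2 * h y + - rate * N y) * expR (- rate * y)))) => //; last exact: ltW.
    + by move=> y y0; exact: (is_deriveN_fun (dexp (- rate) y y0)).
    + move=> y y0; rewrite -mulNr mulr_ge0 ?expR_ge0//.
      by have := h_le y0; rewrite ler_norml => /andP[]; lra.
  rewrite lerN2 => le; rewrite -(pmulr_lgt0 _ (expR_gt0 (- rate * x))).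
  by apply: lt_le_trans le; rewrite mulr_gt0// expR_gt0.
Qed.

Hypothesis N_gt0 : forall x, 0 < x -> 0 < N x.

Let I x := (N x)^-1.

Let dI x : 0 < x -> is_derive x 1 I (- (I x ^+ 2 * (2 * h x))).
Proof.
move=> x0; rewrite /I; derive_eq.
  exact: (is_deriveV_fun (lt0r_neq0 (N_gt0 x0)) (dN x0)).
by rewrite exprVn mulNr.
Qed.

(** The nonlinear terms cancel: the energy identity makes the equation of 1/N
    linear. *)
Let ddI x : 0 < x ->
  is_derive x 1 (fun y => - (I y ^+ 2 * (2 * h y))) (rate ^+ 2 * I x).
Proof.
move=> x0; have dIx := dI x0.
have dhx : is_derive x 1 h (2 * omega * N x - N x ^+ 3 / 4).
  have dpy := dp x0; have dqy := dq x0; have dGy := dG x0; have dHy := dH x0.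
  rewrite /h; derive_eq; first by derive_tac.
  transitivity (G x ^+ 2 + H x ^+ 2 + omega * N x - 3 / 16 * N x ^+ 3).
    by rewrite /N /=; ring.
  by rewrite wave_energy//; field.
derive_eq; first by derive_tac.
have Nx := lt0r_neq0 (N_gt0 x0).
transitivity (- (2 * I x ^+ 2 * (2 * omega * N x - N x ^+ 3 / 4)) +
   8 * I x ^+ 3 * h x ^+ 2).
  by rewrite /=; ring.
by rewrite h_sqr// rate_sqr /I; field.
Qed.

(** For a solution [I] of a linear equation, [(I' + rate I) expR (- rate x)] and
    [(I' - rate I) expR (rate x)] are constant; they give A and B.  The product
    A B comes from the first integral rate^2 I^2 - I'^2 = 1/4. *)
Lemma wave_profile : exists A B : R, [/\ 0 < A, 0 < B, 64 * omega * (A * B) = 1 &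
  forall x, 0 < x -> N x = (A * expR (rate * x) + B * expR (- (rate * x)))^-1].
Proof.
have k0 := rate_gt0; have kn0 := lt0r_neq0 k0.
pose J x := - (I x ^+ 2 * (2 * h x)).
pose a x := (J x + rate * I x) * expR (- (rate * x)).
pose b x := (J x - rate * I x) * expR (rate * x).
have da x : 0 < x -> is_derive x 1 a 0.
  move=> x0; have dIx := dI x0; have dJx : is_derive x 1 J _ := ddI x0.
  rewrite /a; derive_eq; first by derive_tac.
  by rewrite /= -/(J x); ring.
have db x : 0 < x -> is_derive x 1 b 0.
  move=> x0; have dIx := dI x0; have dJx : is_derive x 1 J _ := ddI x0.
  rewrite /b; derive_eq; first by derive_tac.
  by rewrite /= -/(J x); ring.
pose A := a 1 / (2 * rate); pose B := - b 1 / (2 * rate).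
have ee x : expR (- (rate * x)) * expR (rate * x) = 1 :> R.
  by rewrite -expRD addNr expR0.
have aE x : 0 < x -> J x + rate * I x = 2 * rate * A * expR (rate * x).
  move=> x0; rewrite /A (constant_of_derivative da ltr01 x0) /a.
  transitivity ((J x + rate * I x) * (expR (- (rate * x)) * expR (rate * x))).
    by rewrite ee mulr1.
  by field.
have bE x : 0 < x -> rate * I x - J x = 2 * rate * B * expR (- (rate * x)).
  move=> x0; rewrite /B (constant_of_derivative db ltr01 x0) /b.
  transitivity ((rate * I x - J x) * (expR (- (rate * x)) * expR (rate * x))).
    by rewrite ee mulr1.
  by field.
have IE x : 0 < x -> I x = A * expR (rate * x) + B * expR (- (rate * x)).
  have k2 : 2 * rate != 0 by rewrite mulf_neq0.
  by move=> x0; apply: (mulfI k2); have := aE x x0; have := bE x x0; lra.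
have AB : 64 * omega * (A * B) = 1.
  have x0 : 0 < 1 :> R by exact: ltr01.
  have Nx := lt0r_neq0 (N_gt0 x0).
  have : (rate * I 1) ^+ 2 - J 1 ^+ 2 = 4 * rate ^+ 2 * (A * B).
    have -> : (rate * I 1) ^+ 2 - J 1 ^+ 2 =
       (J 1 + rate * I 1) * (rate * I 1 - J 1) by ring.
    transitivity (4 * rate ^+ 2 * (A * B) * (expR (- (rate * 1)) * expR (rate * 1))).
      by rewrite aE// bE//; ring.
    by rewrite ee mulr1.
  have -> : (rate * I 1) ^+ 2 - J 1 ^+ 2 = 4^-1.
    have -> : J 1 ^+ 2 = 4 * I 1 ^+ 4 * h 1 ^+ 2 by rewrite /J; ring.
    by rewrite exprMn rate_sqr h_sqr// /I; field.
  rewrite rate_sqr; lra.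
have Ipos x : 0 < x -> 0 < I x by move=> /N_gt0; rewrite invr_gt0.
have AB0 : 0 < A * B by rewrite -(@pmulr_rgt0 _ (64 * omega)) ?AB// mulr_gt0.
have A0 : 0 < A.
  rewrite ltNge; apply/negP => A0.
  have B0 : B <= 0.
    rewrite leNgt; apply/negP => B0; move: AB0; rewrite ltNge => /negP; apply.
    by rewrite mulr_le0_ge0// ltW.
  have := Ipos 1 ltr01; rewrite IE// ltNge => /negP; apply.
  have := mulr_le0_ge0 A0 (expR_ge0 (rate * 1)).
  by have := mulr_le0_ge0 B0 (expR_ge0 (- (rate * 1))); lra.
exists A, B; split => //; first by rewrite -(pmulr_rgt0 _ A0).
by move=> x x0; rewrite -IE// invrK.
Qed.

(** With zero momentum, [p] and [q] solve the same first order linear equation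
    u' = (h / N) u as [Num.sqrt N]. *)
Lemma wave_phase : exists c s : R, c ^+ 2 + s ^+ 2 = 1 /\
  forall x, 0 < x -> p x = c * Num.sqrt (N x) /\ q x = s * Num.sqrt (N x).
Proof.
have sqN x : 0 < x -> Num.sqrt (N x) != 0.
  by move=> /N_gt0 Nx; rewrite gt_eqF// sqrtr_gt0.
have sqN2 x : Num.sqrt (N x) ^+ 2 = N x by rewrite sqr_sqrtr.
have dS x : 0 < x -> is_derive x 1 (fun y => Num.sqrt (N y)) (h x / Num.sqrt (N x)).
  move=> x0; derive_eq.
    exact: (is_derive_comp_fun (is_derive1_sqrt (N_gt0 x0)) (dN x0)).
  by field; exact: sqN.
have const (u U : R -> R) : (forall x, 0 < x -> is_derive x 1 u (U x)) ->
    (forall x, 0 < x -> U x * N x = u x * h x) ->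
    forall x, 0 < x -> u x / Num.sqrt (N x) = u 1 / Num.sqrt (N 1).
  move=> du uU; suff df x : 0 < x -> is_derive x 1 (fun y => u y / Num.sqrt (N y)) 0.
    by move=> x x0; exact: (constant_of_derivative df).
  move=> x0; have dux := du x x0.
  have dVx := @is_deriveV_fun _ (fun y => Num.sqrt (N y)) x _ (sqN x x0) (dS x x0).
  derive_eq; first by derive_tac.
  rewrite /=; set r := Num.sqrt (N x).
  have r0 : r != 0 := sqN x x0.
  transitivity ((U x * r ^+ 2 - u x * h x) / r ^+ 3); first by field.
  by rewrite sqN2 uU// subrr mul0r.
have pc x : 0 < x -> p x / Num.sqrt (N x) = p 1 / Num.sqrt (N 1).
  apply: const => // y y0; have e := wave_momentum y0.
  have -> : G y * N y = p y * (p y * G y) + q y * (q y * G y) by rewrite /N; ring.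
  by rewrite -e /h; ring.
have qc x : 0 < x -> q x / Num.sqrt (N x) = q 1 / Num.sqrt (N 1).
  apply: const => // y y0; have e := wave_momentum y0.
  have -> : H y * N y = p y * (p y * H y) + q y * (q y * H y) by rewrite /N; ring.
  by rewrite e /h; ring.
exists (p 1 / Num.sqrt (N 1)), (q 1 / Num.sqrt (N 1)); split.
  by rewrite !expr_div_n -mulrDl sqN2 divff// gt_eqF// N_gt0.
by move=> x x0; rewrite -(pc x x0) -(qc x x0) !divfK// sqN.
Qed.

End StandingWave.

(** * The boundary value *)

Section Conclusion.
Variable R : realType.
Implicit Types (f g h u : R -> R) (x y z r s t : R) (v w : H1 R).
Local Notation mu := (@lebesgue_measure R).
Local Notation Rpos := (@Rpos R).
Hint Resolve measurable_Rpos : core.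

(** An explicit primitive that tends to zero at infinity computes an integral over
    the half-line; integrability of [f] makes the limit along integers enough. *)
Lemma int_pos_FTC f F : (forall x, is_derive x 1 F (f x)) -> continuous f ->
  integrable_pos f -> F (n.+1%:R) @[n --> \oo] --> (0 : R) -> int_pos f = - F 0.
Proof.
move=> dF cf Lf F0.
have c1 : int_pos (fun s => f s * \1_[set` `]0, n.+1%:R]] s) @[n --> \oo]
    --> int_pos (fun s => f s * cst 1 s).
  apply: int_pos_dominated => //.
  - by move=> n; apply: measurable_indic; exact: measurable_itv.
  - by move=> n s; rewrite indicE; case: (_ \in _); rewrite ?normr1 ?normr0.
  - move=> x x0; apply: cvg_near_cst.
    have := nbhs_infty_ger x; apply: filterS => n xn.
    by rewrite indicE mem_setE in_itv/= x0 (le_trans xn)// ler_nat.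
have c2 : int_pos (fun s => f s * \1_[set` `]0, n.+1%:R]] s) @[n --> \oo] --> - F 0.
  have -> : (fun n : nat => int_pos (fun s => f s * \1_[set` `]0, n.+1%:R]] s)) =
      (fun n => F n.+1%:R - F 0).
    apply/funext => n; rewrite (@int_pos_support _ _ `]0, n.+1%:R]).
    - rewrite -(Rintegral_FTC2 _ dF cf)//.
      rewrite -Rintegral_itv_obnd_cbnd; last first.
        apply: (integrableS measurable_Rpos (measurable_itv_lebesgue _) _ Lf).
        by move=> x /=; rewrite RposE in_itv/= => /andP[].
      by apply: eq_Rintegral => s sn; rewrite indicE sn mulr1.
    - by move=> s /=; rewrite RposE in_itv/= => /andP[].
    - by move=> s _ ns; rewrite indicE mem_setE (negbTE ns) mulr0.
  by rewrite -[X in _ --> X]add0r; apply: cvgD => //; exact: cvg_cst.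
rewrite -(cvg_unique _ c1 c2) //.
by apply: eq_int_pos => x _; rewrite mulr1.
Qed.

Section Profile.
Variables (omega A B : R).
Hypotheses (omega_gt0 : 0 < omega) (A_gt0 : 0 < A) (B_gt0 : 0 < B).
Hypothesis AB : 64 * omega * (A * B) = 1.

Let k := rate omega.

Let D x := A * expR (k * x) + B * expR (- (k * x)).

Let M x := A * expR (k * x) - B * expR (- (k * x)).

Let D_gt0 x : 0 < D x. Proof. by rewrite addr_gt0// mulr_gt0// expR_gt0. Qed.

Let W x := (D x)^-1.

(** Half the derivative of the profile [W]. *)
Let flux x := - (k / 2) * (M x * W x ^+ 2).

Let dD x : is_derive x 1 D (k * M x).
Proof. by rewrite /D; derive_eq; [derive_tac|rewrite /M /=; ring]. Qed.

Let dM x : is_derive x 1 M (k * D x).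
Proof. by rewrite /M; derive_eq; [derive_tac|rewrite /D /=; ring]. Qed.

Let dflux x : is_derive x 1 flux (2 * omega * W x - W x ^+ 3 / 4).
Proof.
have d0 := lt0r_neq0 (D_gt0 x).
have dMx := dM x; have dWx : is_derive x 1 W _ := is_deriveV_fun d0 (dD x).
rewrite /flux; derive_eq; first by derive_tac.
have M2 : M x ^+ 2 = D x ^+ 2 - 4 * (A * B).
  have e1 : expR (k * x) * expR (- (k * x)) = 1 :> R by rewrite -expRD addrN expR0.
  transitivity (D x ^+ 2 - 4 * (A * B) * (expR (k * x) * expR (- (k * x)))).
    by rewrite /M /D; ring.
  by rewrite e1 mulr1.
transitivity (k ^+ 2 * (- 2^-1 / D x + M x ^+ 2 / D x ^+ 3)).
  by rewrite /= /W; field.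
rewrite M2 rate_sqr//.
transitivity (2 * omega / D x - (64 * omega * (A * B)) / (4 * D x ^+ 3)).
  by field.
by rewrite AB /W; field.
Qed.

(** The modulus is at most k W / 2 <= k / (2 A e^(kx)), and e^(kx) >= kx. *)
Let flux_cvg : flux n.+1%:R @[n --> \oo] --> (0 : R).
Proof.
have k0 : 0 < k := rate_gt0 omega_gt0.
have c : (fun n => (2 * A)^-1 * harmonic n) @ \oo --> (0 : R).
  by rewrite -[X in _ --> X](mulr0 (2 * A)^-1); apply: cvgMr; exact: cvg_harmonic.
apply/norm_cvg0P; apply: (squeeze_cvgr _ (cvg_cst 0) c).
apply: nearW => n; rewrite normr_ge0/=; set x : R := n.+1%:R.
have x0 : 0 < x by rewrite ltr0n.
have MD : `|M x| <= D x.
  rewrite ler_norml /M /D.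
  have := mulr_gt0 A_gt0 (expR_gt0 (k * x)).
  by have := mulr_gt0 B_gt0 (expR_gt0 (- (k * x))); lra.
have W0 : 0 < W x by rewrite invr_gt0.
have k20 : 0 <= k / 2 by rewrite divr_ge0// ltW.
have fW : `|flux x| <= k / 2 * W x.
  rewrite /flux normrM normrN (ger0_norm k20) ler_wpM2l//.
  rewrite normrM (ger0_norm (sqr_ge0 _)).
  apply: (@le_trans _ _ (D x * W x ^+ 2)); first by rewrite ler_wpM2r ?sqr_ge0.
  by rewrite expr2 mulrA /W divff ?mul1r// gt_eqF.
apply: (le_trans fW); rewrite /harmonic -/x /W.
have DA : A * (k * x) <= D x.
  have h1 : k * x <= expR (k * x) by apply: le_trans (expR_ge1Dx _); lra.
  have h2 : A * (k * x) <= A * expR (k * x) by rewrite ler_wpM2l// ltW.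
  by apply: (le_trans h2); rewrite lerDl mulr_ge0 ?expR_ge0// ltW.
have -> : (2 * A)^-1 * x^-1 = k / 2 * (A * (k * x))^-1.
  by field; rewrite !gt_eqF.
rewrite ler_wpM2l//.
have Akx : 0 < A * (k * x) by apply: mulr_gt0 => //; exact: mulr_gt0.
by rewrite lef_pV2 ?posrE ?D_gt0.
Qed.

Lemma profile_continuous : continuous (fun x => (A * expR (rate omega * x) +
  B * expR (- (rate omega * x)))^-1).
Proof.
move=> x; apply: (@is_derive_continuous _ W).
exact: (is_deriveV_fun (lt0r_neq0 (D_gt0 x)) (dD x)).
Qed.

(** The integrand is the derivative of the flux, by [64 omega A B = 1], so that
    the integral is minus the flux at 0. *)
Lemma int_profile : integrable_pos (fun x => 2 * omega * W x - W x ^+ 3 / 4) ->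
  int_pos (fun x => 2 * omega * W x - W x ^+ 3 / 4) = k * (A - B) / (2 * (A + B) ^+ 2).
Proof.
move=> LW; rewrite (int_pos_FTC dflux _ LW flux_cvg).
  rewrite /flux /M /W /D mulr0 oppr0 expR0 !mulr1; field.
  by rewrite gt_eqF// addr_gt0.
move=> x; have cW : {for x, continuous W} by exact: profile_continuous.
apply: cvgB; first by apply: cvgMr.
by apply: cvgMl; exact: (continuous_comp cW (@exprn_continuous R 3 (W x))).
Qed.

End Profile.

End Conclusion.

(** * Minimizers *)

Section Final.
Variable R : realType.
Implicit Types (f g h u : R -> R) (x y z r s t : R) (v w : H1 R).
Local Notation mu := (@lebesgue_measure R).
Local Notation Rpos := (@Rpos R).
Hint Resolve measurable_Rpos : core.

Definition force (omega : R) v u x := omega * u x - 3 / 16 * (sqmod v x ^+ 2 * u x).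

Lemma sqr_integrable_force omega v u : sqr_integrable u -> sqr_integrable (force omega v u).
Proof.
move=> Lu; have := sqr_integrableD (sqr_integrableZ omega Lu) (sqr_integrableZ (- (3 / 16)) (sqr_integrable_sqmod2M v Lu)).
congr sqr_integrable; apply/funext => x; rewrite /force; ring.
Qed.

Lemma force_continuous omega v u x : {for x, continuous (re v)} ->
  {for x, continuous (im v)} -> {for x, continuous u} ->
  {for x, continuous (force omega v u)}.
Proof.
move=> cr ci cu.
have X n (k : R -> R) : {for x, continuous k} -> {for x, continuous (fun y => k y ^+ n)}.
  by move=> ck; exact: (continuous_comp ck (@exprn_continuous R n (k x))).
have cs : {for x, continuous (sqmod v)} by apply: cvgD; exact: X.
apply: cvgB; first exact: cvgMr.
by apply: cvgMr; apply: cvgM => //; exact: (X 2).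
Qed.

Lemma Euler_Lagrange_weak alpha omega v : minimizer alpha omega v ->
  weak_on_plateaus (re (H1_der v)) (force omega v (re v)) /\
  weak_on_plateaus (im (H1_der v)) (force omega v (im v)).
Proof.
move=> vmin; have [Lr Lr'] := H1_re v; have [Li Li'] := H1_im v.
have comb (c d : R) f : test_function f ->
  int_pos (fun x => (c * re (H1_der v) x + d * im (H1_der v) x) * derive1 f x) =
  - int_pos (fun x => force omega v (fun x => c * re v x + d * im v x) x * f x).
  move=> tf; have [Lf _] := test_function_sqr_integrable tf.
  have Lm : sqr_integrable (fun x => c * re v x + d * im v x) by apply: sqr_integrableD; exact: sqr_integrableZ.
  have Lmf := integrable_posM Lm Lf; have Lcf := integrable_posM (sqr_integrable_sqmod2M v Lm) Lf.
  have := minimizer_critical c d vmin tf.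
  rewrite -(int_posZ omega Lmf) -(int_posZ (3 / 16) Lcf) => e.
  rewrite -[LHS](addrK (int_pos (fun x => omega * ((c * re v x + d * im v x) * f x)))) e.
  rewrite -int_posB; [|exact: integrable_posZ..].
  rewrite -mulN1r -int_posZ; last by apply: integrable_posM => //; exact: sqr_integrable_force.
  by apply: eq_int_pos => x _; rewrite /force; ring.
split; apply: plateau_weak => f tf.
- have := comb 1 0 f tf.
  rewrite (@eq_int_pos _ _ (fun x => re (H1_der v) x * derive1 f x)); last first.
    by move=> x _; ring.
  by move=> ->; congr (- _); apply: eq_int_pos => x _; rewrite /force; ring.
- have := comb 0 1 f tf.
  rewrite (@eq_int_pos _ _ (fun x => im (H1_der v) x * derive1 f x)); last first.
    by move=> x _; ring.
  by move=> ->; congr (- _); apply: eq_int_pos => x _; rewrite /force; ring.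
Qed.

Lemma within_Rnneg_at0 u : {within @Rnneg R, continuous u} -> u x @[x --> 0^'+] --> u 0.
Proof. by rewrite /Rnneg => /continuous_within_itvcyP[]. Qed.

(** Nonvanishing at a point is what the equation propagates. *)
Lemma H1_nonzero_point v : H1_nonzero v -> exists2 x, 0 < x & sqmod v x != 0.
Proof.
move=> nz; apply: contrapT => no; apply: nz; apply: aeW => x; rewrite RposE => x0.
have : sqmod v x = 0.
  by apply: contrapT => /eqP sx; apply: no; exists x.
move/eqP; rewrite /sqmod paddr_eq0 ?sqr_ge0// !sqrf_eq0 /re /im.
by case: (H1_fun v x) => a b /= /andP[/eqP -> /eqP ->].
Qed.

(** A constant phase times the profile of [wave_profile].  The relation between A
    and B is the constraint K(v) = 0, evaluated once through the energy identity
    and once through the explicit primitive of [int_profile]. *)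
Lemma minimizer_shape alpha omega v : 0 < omega -> minimizer alpha omega v ->
  exists A B c s : R, [/\ 0 < A, 0 < B, 64 * omega * (A * B) = 1,
    Num.sqrt omega * (A - B) = - alpha * (A + B) &
    c ^+ 2 + s ^+ 2 = 1 /\ forall x, 0 < x -> v x = Complex c s *
      (Num.sqrt (A * expR (rate omega * x) + B * expR (- (rate omega * x)))^-1)%:C%C].
Proof.
move=> om0 vmin; have [Wr Wi] := Euler_Lagrange_weak vmin.
have [Lr Lr'] := H1_re v; have [Li Li'] := H1_im v.
have cr x : 0 < x -> {for x, continuous (re v)} by move=> /(H1_continuous_pos v)[].
have ci x : 0 < x -> {for x, continuous (im v)} by move=> /(H1_continuous_pos v)[].
have cFr x : 0 < x -> {for x, continuous (force omega v (re v))}.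
  by move=> x0; apply: force_continuous; [exact: cr|exact: ci|exact: cr].
have cFi x : 0 < x -> {for x, continuous (force omega v (im v))}.
  by move=> x0; apply: force_continuous; [exact: cr|exact: ci|exact: ci].
have [G [dp dG LG PG]] := weak_derivative_regular Lr Lr' (sqr_integrable_force omega v Lr)
  (@H1_plateau_re _ v) Wr cr cFr.
have [H [dq dH LH QH]] := weak_derivative_regular Li Li' (sqr_integrable_force omega v Li)
  (@H1_plateau_im _ v) Wi ci cFi.
have LN3 := integrable_pos_sqmod3 v.
have LN := integrable_pos_sqmod_H1 v.
have [[_ nz] _] := vmin.
have [x1 x10 Nx1] := H1_nonzero_point nz.
have Npos : forall x, 0 < x -> 0 < sqmod v x.
  exact: (wave_nonvanishing om0 dp dq dG dH Lr Li LG LH LN3 x10 Nx1).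
have [A [B [A0 B0 AB NE]]] := wave_profile om0 dp dq dG dH Lr Li LG LH LN3 Npos.
have [c [s [cs pq]]] := wave_phase dp dq dG dH Lr Li LG LH Npos.
exists A, B, c, s; split => //; last first.
  split => // x x0; have [pc qs] := pq x x0.
  rewrite -[in RHS](NE x x0); set n := Num.sqrt _ in pc qs *.
  transitivity (Complex (c * n) (s * n)).
    by rewrite -pc -qs /re /im; case: (H1_fun v x).
  by apply/eqP; rewrite eq_complex /=; apply/andP; split; apply/eqP; ring.
pose W x := (A * expR (rate omega * x) + B * expR (- (rate omega * x)))^-1.
have {}NE x : 0 < x -> sqmod v x = W x by move=> x0; exact: NE.
(* The trace at 0 is the limit of the profile on the open half-line. *)
have N0 : sqmod v 0 = (A + B)^-1.
  have cN : sqmod v x @[x --> 0^'+] --> sqmod v 0.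
    have [wr wi] := H1_continuous v.
    by apply: cvgD; apply: (cvg_comp _ _ (within_Rnneg_at0 _) (@exprn_continuous R 2 _)).
  have cW : W x @[x --> 0^'+] --> W 0.
    have cW : continuous W by exact: profile_continuous.
    by apply: cvg_at_right_filter; exact: cW.
  have cN' : sqmod v x @[x --> 0^'+] --> W 0.
    apply: cvg_trans cW; apply: near_eq_cvg.
    by apply: filterS (nbhs_right_gt 0) => x x0; rewrite -NE.
  rewrite (cvg_unique _ cN cN')//.
  by rewrite /W mulr0 oppr0 expR0 !mulr1.
have Lpsi : integrable_pos (fun x => 2 * omega * sqmod v x - sqmod v x ^+ 3 / 4).
  apply: integrable_posB; first exact: integrable_posZ.
  by apply: eq_integrable_pos (integrable_posZ 4^-1 LN3) => x _; rewrite mulrC.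
have J1 : int_pos (fun x => 2 * omega * sqmod v x - sqmod v x ^+ 3 / 4) =
    rate omega * (A - B) / (2 * (A + B) ^+ 2).
  rewrite (@eq_int_pos _ _ (fun x => 2 * omega * W x - W x ^+ 3 / 4)); last first.
    by move=> x x0; rewrite NE.
  apply: int_profile => //.
  by apply: eq_integrable_pos Lpsi => x x0; rewrite NE.
have J2 : int_pos (sqmod (H1_der v)) = omega * int_pos (sqmod v) - 16^-1 * sextic v.
  rewrite /sextic -(int_posZ _ LN) -(int_posZ _ LN3) -int_posB; [|exact: integrable_posZ..].
  apply: int_pos_ae.
  - exact: measurable_sqmod Lr'.1 Li'.1.
  - apply: measurable_funB; apply: measurable_funM => //.
      exact: measurable_sqmod_H1.
    by apply: measurable_funX; exact: measurable_sqmod_H1.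
  case: PG => N1 [mN1 N10 s1]; case: QH => N2 [mN2 N20 s2].
  exists (N1 `|` N2); split; first exact: measurableU.
    exact: null_set_setU.
  move=> x /= nx; apply: contrapT => /not_orP[n1 n2]; apply: nx => Rx.
  have PGx : re (H1_der v) x = G x by apply: contrapT => e; apply: n1; apply: s1 => /(_ Rx).
  have QHx : im (H1_der v) x = H x by apply: contrapT => e; apply: n2; apply: s2 => /(_ Rx).
  have x0 : 0 < x by rewrite -RposE.
  by rewrite /sqmod PGx QHx (wave_energy dp dq dG dH Lr Li LG LH LN3 x0) /sqmod; field.
have [qv sv _] := minimizer_sextic vmin.
have J3 : int_pos (fun x => 2 * omega * sqmod v x - sqmod v x ^+ 3 / 4) =
    2 * omega * int_pos (sqmod v) - 4^-1 * sextic v.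
  rewrite /sextic -(int_posZ _ LN) -(int_posZ _ LN3) -int_posB; [|exact: integrable_posZ..].
  by apply: eq_int_pos => x _; rewrite [_ / 4]mulrC.
have AB0 : A + B != 0 by rewrite gt_eqF// addr_gt0.
have : rate omega * (A - B) / (2 * (A + B) ^+ 2) = - alpha / (A + B).
  rewrite -J1 J3; move: qv; rewrite /quadratic J2 N0; lra.
move=> e; have : rate omega * (A - B) = - alpha / (A + B) * (2 * (A + B) ^+ 2).
  by rewrite -e; field.
have -> : - alpha / (A + B) * (2 * (A + B) ^+ 2) = 2 * (- alpha * (A + B)) by field.
rewrite /rate; lra.
Qed.

Lemma unit_circle (c s : R) : c ^+ 2 + s ^+ 2 = 1 ->
  exists theta, Complex c s = expi theta.
Proof.
move=> cs; have c1 : -1 <= c <= 1.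
  rewrite -ler_norml -(@ler_pXn2r _ 2)// ?nnegrE// real_normK ?num_real// expr1n.
  by have := sqr_ge0 s; lra.
have s2 : 1 - c ^+ 2 = s ^+ 2 by lra.
have [s0|s0] := leP 0 s.
- exists (acos c); rewrite /expi acosK ?in_itv//= sin_acos// s2.
  by rewrite sqrtr_sqr ger0_norm.
- exists (- acos c); rewrite /expi cosN sinN acosK ?in_itv//= sin_acos// s2.
  by rewrite sqrtr_sqr ltr0_norm// opprK.
Qed.

(** Writing E for the exponential of the artanh shift, the two relations between A
    and B say that E^2 = A / B and (8 sqrt omega A)^2 = A / B, that is
    E = 8 sqrt omega A and 1 / E = 8 sqrt omega B. *)
Lemma phiE alpha omega A B x : alpha ^+ 2 < omega -> 0 < A -> 0 < B ->
  64 * omega * (A * B) = 1 -> Num.sqrt omega * (A - B) = - alpha * (A + B) -> 0 < x ->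
  phi alpha omega x =
  Num.sqrt (A * expR (rate omega * x) + B * expR (- (rate omega * x)))^-1.
Proof.
move=> aom A0 B0 AB bd x0.
have om0 : 0 < omega by apply: le_lt_trans aom; exact: sqr_ge0.
set r := Num.sqrt omega in bd *.
have r0 : 0 < r by rewrite sqrtr_gt0.
have r2 : r ^+ 2 = omega by rewrite sqr_sqrtr// ltW.
have ar : `|alpha| < r.
  by rewrite -(@ltr_pXn2r _ 2)// ?nnegrE ?(ltW r0)// real_normK ?num_real// r2.
have /andP[ar1 ar2] : - r < alpha < r by rewrite -ltr_norml.
pose E := expR (artanh (- alpha / r)).
have E0 : 0 < E by exact: expR_gt0.
have E2 : E ^+ 2 = (r - alpha) / (r + alpha).
  have n1 : 0 < r - alpha by lra.
  have n2 : 0 < r + alpha by lra.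
  have e : (1 + - alpha / r) / (1 - - alpha / r) = (r - alpha) / (r + alpha).
    by field; rewrite !gt_eqF//; lra.
  rewrite /E /artanh e expr2 -expRD -mulrDl.
  have -> : 2^-1 + 2^-1 = 1 :> R by field.
  by rewrite mul1r lnK// posrE divr_gt0.
have EA : E = 8 * r * A.
  apply/eqP; rewrite -(@eqrXn2 _ 2)// ?(ltW E0) ?mulr_ge0 ?(ltW r0) ?(ltW A0)//.
  rewrite E2; have n2 : r + alpha != 0 by rewrite gt_eqF//; lra.
  apply/eqP; apply: (mulIf n2); rewrite divfK//.
  have h1 : A * (r + alpha) = B * (r - alpha) by lra.
  have -> : (8 * r * A) ^+ 2 * (r + alpha) = 64 * r ^+ 2 * A * (A * (r + alpha)) by ring.
  rewrite h1 r2; have -> : 64 * omega * A * (B * (r - alpha)) =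
    64 * omega * (A * B) * (r - alpha) by ring.
  by rewrite AB mul1r.
have EB : E^-1 = 8 * r * B.
  rewrite EA; have rn := lt0r_neq0 r0; have An := lt0r_neq0 A0.
  apply: (mulfI (_ : 8 * r * A != 0)); first by rewrite !mulf_neq0.
  rewrite divff ?mulf_neq0// -[LHS]AB -r2; ring.
have sech_ge0 : 0 <= sech (2 * r * `|x| + artanh (- alpha / r)).
  by rewrite /sech divr_ge0// addr_ge0// expR_ge0.
rewrite /phi -/r powR12_sqrt//.
have w0 : 0 <= 2 * omega `^ 4^-1 by rewrite mulr_ge0// powR_ge0.
have w2 : (2 * omega `^ 4^-1) ^+ 2 = 4 * r.
  have -> : r = (omega `^ 4^-1) ^+ 2.
    rewrite -powR_mulrn ?powR_ge0// -powRrM.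
    have -> : 4^-1 * 2 = 2^-1 :> R by field.
    by rewrite powR12_sqrt// ltW.
  ring.
rewrite -[2 * _](ger0_norm w0) -sqrtr_sqr w2 -sqrtrM ?mulr_ge0 ?(ltW r0)//.
congr Num.sqrt; rewrite /sech (gtr0_norm x0) opprD !expRD expRN -/E.
have -> : expR (- artanh (- alpha / r)) = E^-1 by rewrite expRN.
rewrite EB EA /rate -/r ?expRN.
set e := expR (2 * r * x); have en : e != 0 by rewrite gt_eqF// expR_gt0.
have e0 : 0 < e by exact: expR_gt0.
field.
by rewrite !gt_eqF// ?addr_gt0 ?mulr_gt0.
Qed.

End Final.

Theorem proposition1p3 (R : realType) (omega alpha : R)
    (homega : alpha ^+ 2 < omega) (v : H1 R) (hv : minimizer alpha omega v) :
  exists theta : R, forall x : R, 0 < x ->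
    v x = expi theta * (phi alpha omega x)%:C%C.
Proof.
have om0 : 0 < omega by apply: le_lt_trans homega; exact: sqr_ge0.
have [A [B [c [s [A0 B0 AB bd [cs vE]]]]]] := minimizer_shape om0 hv.
have [theta e] := unit_circle cs.
by exists theta => x x0; rewrite vE// (phiE homega A0 B0 AB bd x0) -e.
Qed.
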